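(* Let $n\ge 2$ be an integer, $k,c_b>0$, $\rho_0>0$, and let $\lambda_{1,0},\dots,\lambda_{n,0}$ be real numbers with $\lambda_{1,0}=\cdots=\lambda_{J,0}<\lambda_{J+1,0}\le\cdots\le\lambda_{n,0}$ for some integer $1\le J\le n$. Consider the system $$\lambda_i'=-\lambda_i^2+\frac{k}{n}(\rho-c_b)\ (i=1,\dots,n),\qquad \rho'=-\rho\lambda,\quad \lambda=\sum_{i=1}^n\lambda_i,\qquad \rho(0)=\rho_0,\ \lambda_i(0)=\lambda_{i,0},$$ suppose its maximal interval of existence is $[0,t_B)$ with $0<t_B<\infty$, let $u_i(t)=e^{\int_0^t\lambda_i(s)\,ds}$, and let $p,q$ satisfy $\lim_{t\to t_B^-}u_1'(t)u_n(t)=-p$, $\lim_{t\to t_B^-}u_1(t)u_n'(t)=q$. If $p=q$, then $J=2$, $n=4$, and $(\lambda_{1,0}-\lambda_{3,0})(\lambda_{1,0}-\lambda_{4,0})=k\rho_0$. Moreover, there exists $C>0$ such that $\lim_{t\to t_B^-}(t_B-t)^2\lambda_1(t)=-C$, $\lim_{t\to t_B^-}(t_B-t)^2\lambda_i(t)=C$ for $i=3,4$, and $\lim_{t\to t_B^-}(t_B-t)^4\rho(t)=\frac4kC^2$.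
   Context: Solutions are real-valued and continuously differentiable on $[0,t_B)$. It is known that the limits defining $p,q$ exist. *)

(* Defs.v *)
From Stdlib Require Import Reals.
From Coquelicot Require Import Coquelicot.
Open Scope R_scope.

Definition lam_sum (n : nat) (lam : nat -> R -> R) (t : R) : R :=
  sum_n_m (fun i => lam i t) 1 n.

(* (lam, rho) is a C^1 solution on [0,T) of
     lambda_i' = -lambda_i^2 + (k/n)(rho - cb),  rho' = - rho * lambda,
     rho(0) = rho0, lambda_i(0) = lam0 i   (i = 1..n).
   Differentiability on (0,T) plus right-continuity at 0 (the derivatives equal
   continuous right-hand sides, hence the solution is C^1 on [0,T)). *)
Definition is_sol (n : nat) (k cb rho0 : R) (lam0 : nat -> R) (T : R)
    (lam : nat -> R -> R) (rho : R -> R) : Prop :=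
  rho 0 = rho0 /\
  (forall i, (1 <= i <= n)%nat -> lam i 0 = lam0 i) /\
  filterlim rho (at_right 0) (locally (rho 0)) /\
  (forall i, (1 <= i <= n)%nat ->
     filterlim (lam i) (at_right 0) (locally (lam i 0))) /\
  (forall t, 0 < t < T ->
     is_derive rho t (- rho t * lam_sum n lam t) /\
     forall i, (1 <= i <= n)%nat ->
       is_derive (lam i) t (- (lam i t)^2 + k / INR n * (rho t - cb))).

Definition is_maximal_sol (n : nat) (k cb rho0 : R) (lam0 : nat -> R) (tB : R)
    (lam : nat -> R -> R) (rho : R -> R) : Prop :=
  is_sol n k cb rho0 lam0 tB lam rho /\
  forall T, tB < T ->
    ~ (exists lam' rho', is_sol n k cb rho0 lam0 T lam' rho').

Definition u_fun (lam : nat -> R -> R) (i : nat) (t : R) : R :=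
  exp (RInt (lam i) 0 t).

(* Main.v *)
Require Import Defs.
From Stdlib Require Import Reals Lra Lia Arith Classical.
From Coquelicot Require Import Coquelicot.
Open Scope R_scope.

(* All u_i solve u'' = (k/n)(rho - cb) u and rho = rho0 / prod u_i.  Put P = u_1 u_n and
   mu = lam0 n - lam0 1; the Wronskian gives p + q = mu, so p = q means P' -> 0.  Either P stays
   away from 0, and then the solution is bounded and extends past tB, or P -> 0.  If mu = 0, an
   energy estimate forbids P -> 0.  If mu > 0, use x = ln (u_n / u_1) -> +oo as a clock,
   dx/dt = mu / P: then
     mu dP'/dx = P P'' = (2k/n)(rho P^2 - cb P^2) + 2 (u_1' u_n)(u_1 u_n'),
   whose last term tends to - mu^2 / 2, so P' -> 0 forces rho P^2 neither to vanish, nor to blow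
   up, nor to converge to anything but n mu^2 / (4k).  Since
     rho P^2 ~ const * u_1^(2-J) * u_n^(2-n+J),
   this gives first n = 2J, then J = 2, then the relation on the initial data.  Finally
   S = sqrt P satisfies S'' <= 0 with an integrable defect, so S' has a negative limit and
   P ~ c^2 (tB - t)^2, from which all the rates follow. *)

(** * One-sided limits and monotonicity *)

(** Maximality only denies the existence of a solution on a longer interval, so using it requires
    producing one. Hence a local existence theorem whose lifespan is uniform over bounded data; the
    vector field being quadratic, power series with a geometric majorant suffice. The limit P' -> 0
    serves twice. It makes P Lipschitz near tB, so P cannot oscillate between 0 and larger values;
    and since the clock x runs to infinity, it forbids P P'' to keep a definite sign and size. The
    exponents of rho P^2 come from linearity: each u_i is a combination of u_1 and u_n with
    coefficients fixed by the initial rates. The first J of them equal u_1, the others are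
    comparable to u_n because u_n / u_1 -> +oo. The square root appears because the product of two
    solutions of a linear second-order equation leads to an Ermakov equation for S: S'' = - (k/4) cb
    S - (mu^2/4) S^(-3) D. The relation on the initial data is exactly what makes D vanish in the
    limit, at the rate u_1 / u_n, and this is fast enough for S' to converge. *)

Lemma filterlim_Rplus {X : Type} (F : (X -> Prop) -> Prop) (FF : Filter F)
    (f g : X -> R) (a b : R) :
  filterlim f F (locally a) -> filterlim g F (locally b) ->
  filterlim (fun x => f x + g x) F (locally (a + b)).
Proof.
  intros Hf Hg.
  exact (filterlim_comp_2 f g Rplus Hf Hg
           (filterlim_plus (K := R_AbsRing) (V := R_NormedModule) a b)).
Qed.

Lemma filterlim_Rmult {X : Type} (F : (X -> Prop) -> Prop) (FF : Filter F)
    (f g : X -> R) (a b : R) :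
  filterlim f F (locally a) -> filterlim g F (locally b) ->
  filterlim (fun x => f x * g x) F (locally (a * b)).
Proof.
  intros Hf Hg.
  exact (filterlim_comp_2 f g Rmult Hf Hg (filterlim_mult (K := R_AbsRing) a b)).
Qed.

Lemma filterlim_cont {X : Type} (F : (X -> Prop) -> Prop)
    (h : R -> R) (g : X -> R) (a : R) :
  filterlim g F (locally a) -> continuous h a ->
  filterlim (fun x => h (g x)) F (locally (h a)).
Proof. intros Hg Hh. exact (filterlim_comp _ _ _ _ _ _ _ _ Hg Hh). Qed.

Lemma filterlim_Rinv {X : Type} (F : (X -> Prop) -> Prop) (f : X -> R) (a : R) :
  filterlim f F (locally a) -> a <> 0 ->
  filterlim (fun x => / f x) F (locally (/ a)).
Proof.
  intros Hf Ha. apply (filterlim_comp _ _ _ f Rinv _ _ _ Hf).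
  apply continuous_Rinv; exact Ha.
Qed.

Lemma filterlim_eps {X : Type} (F : (X -> Prop) -> Prop) (FF : Filter F) (f : X -> R) (a : R) :
  filterlim f F (locally a) <-> (forall e, 0 < e -> F (fun x => Rabs (f x - a) < e)).
Proof.
  split.
  - intros H e He. apply (H (fun y => Rabs (y - a) < e)).
    exists (mkposreal e He). intros y Hy. exact Hy.
  - intros H Q [e He]. unfold filtermap.
    apply (filter_imp (fun x => Rabs (f x - a) < e)).
    + intros x Hx. apply He. exact Hx.
    + apply H. apply cond_pos.
Qed.

(** The threshold is kept positive so that it lies in the open interval where the equations are
    known to hold. *)
Lemma at_left_iff (T : R) (Q : R -> Prop) :
  0 < T ->
  (at_left T Q <-> exists t0, 0 < t0 < T /\ forall t, t0 <= t < T -> Q t).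
Proof.
  intros HT. split.
  - intros [e He].
    exists (Rmax (T / 2) (T - e / 2)).
    assert (0 < e) by apply cond_pos.
    split.
    + split; [apply Rlt_le_trans with (2 := Rmax_l _ _); lra|].
      apply Rmax_lub_lt; lra.
    + intros t [Ht1 Ht2]. apply He; [|exact Ht2].
      assert (T - e / 2 <= t) by (eapply Rle_trans; [apply Rmax_r|exact Ht1]).
      change (Rabs (t - T) < e). rewrite Rabs_left; lra.
  - intros [t0 [Ht0 H]].
    assert (He : 0 < T - t0) by lra.
    exists (mkposreal _ He). intros t Ht Htl. apply H.
    change (Rabs (t - T) < T - t0) in Ht. rewrite Rabs_left in Ht; lra.
Qed.

Lemma at_left_of (T t0 : R) (Q : R -> Prop) :
  t0 < T -> (forall t, t0 <= t < T -> Q t) -> at_left T Q.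
Proof.
  intros Ht0 H.
  assert (He : 0 < T - t0) by lra.
  exists (mkposreal _ He). intros t Ht Htl. apply H.
  change (Rabs (t - T) < T - t0) in Ht. rewrite Rabs_left in Ht; lra.
Qed.

Lemma increasing_of_derive (f df : R -> R) (a b : R) :
  (forall t, a <= t < b -> is_derive f t (df t)) ->
  (forall t, a <= t < b -> 0 <= df t) ->
  forall s t, a <= s -> s <= t -> t < b -> f s <= f t.
Proof.
  intros Hd Hp s t Hs Hst Ht.
  destruct (MVT_gen f s t df) as [c [Hc E]].
  - intros x Hx. rewrite Rmin_left, Rmax_right in Hx by lra. apply Hd; lra.
  - intros x Hx. rewrite Rmin_left, Rmax_right in Hx by lra.
    apply continuity_pt_filterlim.
    apply (ex_derive_continuous (K := R_AbsRing) (V := R_NormedModule)).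
    exists (df x); apply Hd; lra.
  - rewrite Rmin_left, Rmax_right in Hc by lra.
    assert (0 <= df c) by (apply Hp; lra). nra.
Qed.

(** At 0 only a right limit is available, so the value of a conserved quantity is read off there
    instead of by evaluation. *)
Lemma const_of_derive (f : R -> R) (T c : R) :
  0 < T -> (forall t, 0 < t < T -> is_derive f t 0) ->
  filterlim f (at_right 0) (locally c) ->
  forall t, 0 < t < T -> f t = c.
Proof.
  intros HT Hd Hl t Ht.
  assert (Hl' : filterlim f (at_right 0) (locally (f t))).
  { apply (filterlim_ext_loc (fun _ => f t)).
    - exists (mkposreal t (proj1 Ht)). intros s Hs Hs0.
      change (Rabs (s - 0) < t) in Hs. rewrite Rabs_right in Hs by lra.
      symmetry.
      apply (eq_is_derive (V := R_NormedModule)); [|lra].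
      intros x Hx. apply Hd; lra.
    - apply filterlim_const. }
  apply (filterlim_locally_unique (F := at_right 0) f); assumption.
Qed.

Lemma RInt_from_zero (f : R -> R) (T : R) :
  0 < T -> filterlim f (at_right 0) (locally (f 0)) ->
  (forall t, 0 < t < T -> continuous f t) ->
  (forall t, 0 < t < T -> is_derive (fun x => RInt f 0 x) t (f t)) /\
  filterlim (fun x => RInt f 0 x) (at_right 0) (locally 0).
Proof.
  intros HT H0 Hc.
  (* Nothing is known of [f] to the left of 0. Freezing it at [f 0] there makes [g] continuous on a
     two-sided neighbourhood of 0, where the fundamental theorem applies. *)
  set (g := fun x => f (Rmax 0 x)).
  assert (Hmax : forall x, continuous (fun x => Rmax 0 x) x).
  { intros x. apply filterlim_eps; [apply locally_filter|]. intros e He.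
    exists (mkposreal e He). intros y Hy. change (Rabs (y - x) < e) in Hy.
    revert Hy. unfold Rmax. repeat destruct Rle_dec; unfold Rabs; repeat destruct Rcase_abs; lra. }
  assert (Hg : forall t, t < T -> continuous g t).
  { intros t Ht. destruct (Rlt_le_dec 0 t) as [Htp|Htp].
    - unfold g. apply continuous_comp; [apply Hmax|].
      rewrite Rmax_right by lra. apply Hc; lra.
    - apply filterlim_eps; [apply locally_filter|]. intros e He.
      assert (Hf := proj1 (filterlim_eps _ _ f (f 0)) H0 e He).
      destruct Hf as [d Hd].
      exists d. intros y Hy. change (Rabs (y - t) < d) in Hy.
      unfold g. rewrite (Rmax_left 0 t) by lra.
      destruct (Rlt_le_dec 0 y) as [Hyp|Hyp].
      + rewrite Rmax_right by lra. apply Hd; [|exact Hyp].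
        change (Rabs (y - 0) < d). unfold Rabs in *; repeat destruct Rcase_abs; lra.
      + rewrite Rmax_left by lra. rewrite Rminus_eq_0, Rabs_R0. exact He. }
  assert (Hgd : forall t, t < T -> is_derive (fun x => RInt g 0 x) t (g t)).
  { intros t Ht. apply (is_derive_RInt (V := R_NormedModule) g (fun x => RInt g 0 x) 0).
    - assert (He : 0 < T - t) by lra.
      exists (mkposreal _ He). intros y Hy. change (Rabs (y - t) < T - t) in Hy.
      apply (RInt_correct (V := R_CompleteNormedModule)).
      apply (ex_RInt_continuous (V := R_CompleteNormedModule)). intros z Hz. apply Hg.
      apply Rle_lt_trans with (1 := proj2 Hz). apply Rmax_lub_lt; [lra|].
      revert Hy; unfold Rabs; destruct Rcase_abs; lra.
    - apply Hg; exact Ht. }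
  assert (Heq : forall t, 0 <= t -> RInt g 0 t = RInt f 0 t).
  { intros t Ht. apply (RInt_ext (V := R_CompleteNormedModule)). intros x Hx.
    rewrite Rmin_left in Hx by lra. unfold g. rewrite Rmax_right by lra. reflexivity. }
  split.
  - intros t Ht.
    replace (f t) with (g t) by (unfold g; rewrite Rmax_right; [reflexivity|lra]).
    apply (is_derive_ext_loc (fun x => RInt g 0 x)).
    + exists (mkposreal t (proj1 Ht)). intros y Hy. change (Rabs (y - t) < t) in Hy.
      apply Heq. revert Hy; unfold Rabs; destruct Rcase_abs; lra.
    + apply Hgd; lra.
  - apply (filterlim_ext_loc (fun x => RInt g 0 x)).
    + exists (mkposreal 1 Rlt_0_1). intros y _ Hy. apply Heq; lra.
    + assert (Hcont : continuous (fun x => RInt g 0 x) 0).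
      { apply (ex_derive_continuous (K := R_AbsRing) (V := R_NormedModule)).
        exists (g 0). apply Hgd; lra. }
      assert (E : RInt g 0 0 = 0) by exact (RInt_point (V := R_CompleteNormedModule) 0 g).
      unfold continuous in Hcont. rewrite E in Hcont.
      eapply filterlim_filter_le_1; [|exact Hcont].
      intros Q HQ. unfold at_right, within. apply filter_imp with (2 := HQ). tauto.
Qed.

(** * Local existence by power series *)

Lemma Rabs_sum_n_m_le (a : nat -> R) (c : R) (n : nat) :
  (forall i, Rabs (a i) <= c) -> Rabs (sum_n_m a 1 n) <= INR n * c.
Proof.
  intros H.
  apply Rle_trans with (1 := norm_sum_n_m (K := R_AbsRing) (V := R_NormedModule) a 1 n).
  apply Rle_trans with (sum_n_m (fun _ => c) 1 n).
  - apply sum_n_m_le. exact H.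
  - rewrite sum_n_m_const. replace (S n - 1)%nat with n by lia. lra.
Qed.

(** A Cauchy product of geometrically bounded sequences has [m + 1] terms of the same size; this
    factor is later cancelled by the [INR (S m)] of the coefficient recursion. *)
Lemma PS_mult_bound (a b : nat -> R) (C D B : R) (m : nat) :
  0 < B -> 0 <= C ->
  (forall j, (j <= m)%nat -> Rabs (a j) <= C * B ^ j) ->
  (forall j, (j <= m)%nat -> Rabs (b j) <= D * B ^ j) ->
  Rabs (PS_mult a b m) <= INR (S m) * (C * D * B ^ m).
Proof.
  intros HB HC Ha Hb. unfold PS_mult.
  apply Rle_trans with (1 := Rsum_abs _ _).
  rewrite Rmult_comm, <- sum_cte.
  apply sum_Rle. intros j Hj. rewrite Rabs_mult.
  replace (C * D * B ^ m) with ((C * B ^ j) * (D * B ^ (m - j))).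
  - apply Rmult_le_compat; try apply Rabs_pos; [apply Ha; lia|apply Hb; lia].
  - replace (B ^ m) with (B ^ j * B ^ (m - j)); [ring|].
    rewrite <- pow_add. f_equal. lia.
Qed.

Lemma CV_radius_geometric (a : nat -> R) (C B t : R) :
  0 < B -> (forall m, Rabs (a m) <= C * B ^ m) -> Rabs t * B < 1 ->
  Rbar_lt (Rabs t) (CV_radius a).
Proof.
  intros HB Ha Ht.
  apply Rbar_lt_le_trans with (Finite (/ B)).
  - simpl. apply Rmult_lt_reg_r with B; [exact HB|].
    rewrite Rinv_l by lra. exact Ht.
  - apply (proj1 (CV_radius_bounded a)). exists C. intros m.
    rewrite Rabs_mult, (Rabs_right ((/ B) ^ m)).
    + apply Rmult_le_reg_r with (B ^ m); [apply pow_lt; exact HB|].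
      rewrite Rmult_assoc, <- Rpow_mult_distr, Rinv_l, pow1, Rmult_1_r by lra.
      apply Ha.
    + apply Rle_ge, pow_le, Rlt_le, Rinv_0_lt_compat, HB.
Qed.

(* Component [0] carries [rho - cb] and component [i >= 1] carries [lambda_i]:
   with this shift the vector field has no constant term. *)
Definition sol_field (n : nat) (K cb : R) (A : nat -> nat -> R) (i m : nat) : R :=
  let s := fun j => sum_n_m (fun l => A l j) 1 n in
  match i with
  | O => - PS_mult (A 0%nat) s m - cb * s m
  | S _ => - PS_mult (A i) (A i) m + K * A 0%nat m
  end.

(** Coefficient [m + 1] depends on all components at all orders up to [m], which is not structural
    recursion. Whole tables are built instead: stage [N] is correct up to order [N] and holds filler
    values beyond, and [sol_coef] reads the diagonal. *)
Fixpoint sol_approx (n : nat) (K cb : R) (init : nat -> R) (N : nat) : nat -> nat -> R :=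
  match N with
  | O => fun i _ => init i
  | S N' => fun i m =>
      if le_lt_dec m N' then sol_approx n K cb init N' i m
      else sol_field n K cb (sol_approx n K cb init N') i N' / INR (S N')
  end.

Definition sol_coef (n : nat) (K cb : R) (init : nat -> R) (i m : nat) : R :=
  sol_approx n K cb init m i m.

Lemma PS_mult_ext_le (a b a' b' : nat -> R) (m : nat) :
  (forall j, (j <= m)%nat -> a j = a' j) -> (forall j, (j <= m)%nat -> b j = b' j) ->
  PS_mult a b m = PS_mult a' b' m.
Proof.
  intros Ha Hb. unfold PS_mult. apply sum_eq. intros j Hj.
  rewrite Ha, Hb by lia. reflexivity.
Qed.

Lemma sol_field_ext (n : nat) (K cb : R) (A A' : nat -> nat -> R) (i m : nat) :
  (forall l j, (j <= m)%nat -> A l j = A' l j) ->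
  sol_field n K cb A i m = sol_field n K cb A' i m.
Proof.
  intros H.
  assert (Hs : forall j, (j <= m)%nat ->
            sum_n_m (fun l => A l j) 1 n = sum_n_m (fun l => A' l j) 1 n).
  { intros j Hj. apply sum_n_m_ext. intros l. apply H; exact Hj. }
  destruct i as [|i]; simpl.
  - rewrite Hs by lia. f_equal. f_equal. apply PS_mult_ext_le; auto.
  - rewrite (H 0%nat m) by lia. f_equal. f_equal. apply PS_mult_ext_le; auto.
Qed.

Lemma sol_approx_coef (n : nat) (K cb : R) (init : nat -> R) (N i m : nat) :
  (m <= N)%nat -> sol_approx n K cb init N i m = sol_coef n K cb init i m.
Proof.
  induction N as [|N IH]; intros Hm.
  - replace m with 0%nat by lia. reflexivity.
  - destruct (Nat.eq_dec m (S N)) as [->|Hne]; [reflexivity|].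
    cbn [sol_approx]. destruct (le_lt_dec m N) as [Hle|Hlt]; [apply IH; exact Hle|lia].
Qed.

Lemma sol_coef_S (n : nat) (K cb : R) (init : nat -> R) (i m : nat) :
  INR (S m) * sol_coef n K cb init i (S m) = sol_field n K cb (sol_coef n K cb init) i m.
Proof.
  assert (HS : INR (S m) <> 0) by (apply not_0_INR; lia).
  transitivity (sol_field n K cb (sol_approx n K cb init m) i m).
  - unfold sol_coef. cbn [sol_approx]. destruct (le_lt_dec (S m) m) as [Hle|_]; [lia|].
    field. exact HS.
  - apply sol_field_ext. intros l j Hj. apply sol_approx_coef; exact Hj.
Qed.

(** Strong induction: the factor [m + 1] of the Cauchy product cancels against the recursion, so the
    base must dominate [n M + n cb] for component 0 and [M + K] for the others. It depends on the
    initial data through [M] alone. *)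
Lemma sol_coef_bound (n : nat) (K cb M : R) (init : nat -> R) :
  0 < M -> 0 < K -> 0 < cb -> (forall i, Rabs (init i) <= M) ->
  forall m i, Rabs (sol_coef n K cb init i m)
              <= M * (1 + M + K + INR n * M + INR n * cb) ^ m.
Proof.
  intros HM HK Hcb Hinit.
  assert (Hn : 0 <= INR n) by apply pos_INR.
  assert (HnM : 0 <= INR n * M) by nra.
  assert (Hnc : 0 <= INR n * cb) by nra.
  set (B := 1 + M + K + INR n * M + INR n * cb).
  assert (HB : 0 < B) by (unfold B; lra).
  induction m as [m IH] using lt_wf_ind. intros i.
  destruct m as [|m]; [simpl; rewrite Rmult_1_r; apply Hinit|].
  set (A := sol_coef n K cb init) in *.
  assert (HA : forall l j, (j <= m)%nat -> Rabs (A l j) <= M * B ^ j)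
    by (intros; apply IH; lia).
  assert (Hs : forall j, (j <= m)%nat ->
            Rabs (sum_n_m (fun l => A l j) 1 n) <= (INR n * M) * B ^ j).
  { intros j Hj. rewrite Rmult_assoc. apply Rabs_sum_n_m_le. intros l. apply HA; exact Hj. }
  assert (HS1 : 1 <= INR (S m)) by (rewrite S_INR; pose proof (pos_INR m); lra).
  assert (HBm : 0 < B ^ m) by (apply pow_lt; exact HB).
  apply Rmult_le_reg_l with (INR (S m)); [lra|].
  rewrite <- (Rabs_right (INR (S m))) at 1 by lra.
  rewrite <- Rabs_mult. unfold A. rewrite sol_coef_S. fold A.
  replace (INR (S m) * (M * B ^ S m)) with (INR (S m) * (M * B * B ^ m)) by (simpl; ring).
  destruct i as [|i]; simpl sol_field.
  - pose proof (PS_mult_bound (A 0%nat) _ M (INR n * M) B m HB (Rlt_le _ _ HM)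
                  (HA 0%nat) Hs) as H1.
    pose proof (Hs m (le_n m)) as H2.
    apply Rle_trans with (INR (S m) * (M * (INR n * M) * B ^ m)
                          + cb * (INR n * M * B ^ m)).
    + unfold Rminus. apply Rle_trans with (1 := Rabs_triang _ _).
      apply Rplus_le_compat; [rewrite Rabs_Ropp; exact H1|].
      rewrite Rabs_Ropp, Rabs_mult, (Rabs_right cb) by lra.
      apply Rmult_le_compat_l; [lra|exact H2].
    + assert (cb * (INR n * M * B ^ m) <= INR (S m) * (cb * (INR n * M * B ^ m))).
      { assert (0 <= cb * (INR n * M * B ^ m)) by (apply Rmult_le_pos; [lra|apply Rmult_le_pos; lra]). nra. }
      assert (INR (S m) * ((M * (INR n * M) + cb * (INR n * M)) * B ^ m)
              <= INR (S m) * (M * B * B ^ m)); [|lra].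
      apply Rmult_le_compat_l; [lra|]. apply Rmult_le_compat_r; [lra|].
      unfold B. nra.
  - pose proof (PS_mult_bound (A (S i)) (A (S i)) M M B m HB (Rlt_le _ _ HM)
                  (HA (S i)) (HA (S i))) as H1.
    pose proof (HA 0%nat m (le_n m)) as H2.
    apply Rle_trans with (INR (S m) * (M * M * B ^ m) + K * (M * B ^ m)).
    + apply Rle_trans with (1 := Rabs_triang _ _).
      apply Rplus_le_compat; [rewrite Rabs_Ropp; exact H1|].
      rewrite Rabs_mult, (Rabs_right K) by lra.
      apply Rmult_le_compat_l; [lra|exact H2].
    + assert (K * (M * B ^ m) <= INR (S m) * (K * (M * B ^ m))).
      { assert (0 <= K * (M * B ^ m)) by (apply Rmult_le_pos; [lra|apply Rmult_le_pos; lra]). nra. }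
      assert (INR (S m) * ((M * M + K * M) * B ^ m)
              <= INR (S m) * (M * B * B ^ m)); [|lra].
      apply Rmult_le_compat_l; [lra|]. apply Rmult_le_compat_r; [lra|].
      unfold B. nra.
Qed.

Lemma is_pseries_sum_n_m (A : nat -> nat -> R) (l : nat -> R) (t : R) (n : nat) :
  (forall i, is_pseries (A i) t (l i)) ->
  is_pseries (fun j => sum_n_m (fun i => A i j) 1 n) t (sum_n_m l 1 n).
Proof.
  intros H. induction n as [|n IH].
  - rewrite sum_n_m_zero by lia.
    apply (is_pseries_ext (fun j => scal 0 (A 0%nat j))).
    + intros j. rewrite sum_n_m_zero by lia. apply Rmult_0_l.
    + replace (zero : R) with (scal 0 (l 0%nat) : R) by apply Rmult_0_l.
      apply (is_pseries_scal (K := R_AbsRing) (V := R_NormedModule)); [apply Rmult_comm|apply H].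
  - rewrite sum_n_Sm by lia.
    apply (is_pseries_ext (PS_plus (fun j => sum_n_m (fun i => A i j) 1 n) (A (S n)))).
    + intros j. unfold PS_plus. rewrite sum_n_Sm by lia. reflexivity.
    + apply (is_pseries_plus (K := R_AbsRing) (V := R_NormedModule)); [exact IH|apply H].
Qed.

(** The order of quantifiers is the point: [d] is chosen before the initial data. It is the inverse
    of the geometric base of [sol_coef_bound], hence a function of [n], [K], [cb] and [M]. *)
Lemma local_existence (n : nat) (K cb M : R) :
  0 < M -> 0 < K -> 0 < cb ->
  exists d, 0 < d /\
  forall (l0 : nat -> R) (r0 : R), (forall i, Rabs (l0 i) <= M) -> Rabs (r0 - cb) <= M ->
  exists (lam : nat -> R -> R) (rho : R -> R),
    rho 0 = r0 /\ (forall i, (1 <= i)%nat -> lam i 0 = l0 i) /\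
    forall t, Rabs t < d ->
      is_derive rho t (- rho t * lam_sum n lam t) /\
      forall i, (1 <= i)%nat -> is_derive (lam i) t (- (lam i t) ^ 2 + K * (rho t - cb)).
Proof.
  intros HM HK Hcb.
  set (B := 1 + M + K + INR n * M + INR n * cb).
  assert (HB : 0 < B).
  { unfold B. pose proof (pos_INR n). nra. }
  exists (/ B). split; [apply Rinv_0_lt_compat, HB|].
  intros l0 r0 Hl Hr.
  set (init := fun i => match i with O => r0 - cb | S _ => l0 i end).
  set (A := sol_coef n K cb init).
  assert (HA : forall i m, Rabs (A i m) <= M * B ^ m).
  { intros i m. apply sol_coef_bound; try assumption. intros [|j]; [exact Hr|apply Hl]. }
  exists (fun i => PSeries (A i)), (fun t => PSeries (A 0%nat) t + cb).
  split; [rewrite PSeries_0; unfold A, sol_coef; simpl; ring|].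
  split; [intros [|i] Hi; [lia|]; rewrite PSeries_0; reflexivity|].
  intros t Ht.
  assert (HtB : Rabs t * B < 1).
  { apply Rmult_lt_compat_r with (r := B) in Ht; [|exact HB].
    rewrite Rinv_l in Ht by lra. exact Ht. }
  assert (Hcv : forall i, Rbar_lt (Rabs t) (CV_radius (A i))).
  { intros i. apply (CV_radius_geometric _ M B); auto. }
  assert (Hps : forall i, is_pseries (A i) t (PSeries (A i) t)).
  { intros i. apply PSeries_correct, CV_radius_inside, Hcv. }
  pose proof (is_pseries_sum_n_m A (fun i => PSeries (A i) t) t n Hps) as Hs.
  assert (Hcvs : Rbar_lt (Rabs t) (CV_radius (fun j => sum_n_m (fun i => A i j) 1 n))).
  { apply (CV_radius_geometric _ (INR n * M) B); auto.
    intros m. rewrite Rmult_assoc. apply Rabs_sum_n_m_le. intros i. apply HA. }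
  assert (Hder : forall i v, is_pseries (sol_field n K cb A i) t v ->
                   is_derive (PSeries (A i)) t v).
  { intros i v Hv. replace v with (PSeries (PS_derive (A i)) t).
    - apply is_derive_PSeries, Hcv.
    - apply is_pseries_unique. revert Hv. apply is_pseries_ext.
      intros m. unfold PS_derive, A. rewrite sol_coef_S. reflexivity. }
  split.
  - replace (- (PSeries (A 0%nat) t + cb) * lam_sum n (fun i => PSeries (A i)) t)
      with (plus (opp (PSeries (A 0%nat) t * sum_n_m (fun i => PSeries (A i) t) 1 n))
             (scal (- cb) (sum_n_m (fun i => PSeries (A i) t) 1 n)) + 0 : R).
    2: { unfold lam_sum, plus, opp, scal; simpl; unfold mult; simpl. ring. }
    apply (is_derive_plus (PSeries (A 0%nat)) (fun _ => cb) t _ 0).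
    + apply Hder.
      apply (is_pseries_ext (PS_plus (PS_opp (PS_mult (A 0%nat) (fun j => sum_n_m (fun i => A i j) 1 n)))
                (PS_scal (- cb) (fun j => sum_n_m (fun i => A i j) 1 n)))).
      { intros m. unfold PS_plus, PS_opp, PS_scal, plus, opp, scal; simpl; unfold mult; simpl. ring. }
      apply (is_pseries_plus (K := R_AbsRing) (V := R_NormedModule)).
      * apply (is_pseries_opp (K := R_AbsRing) (V := R_NormedModule)).
        apply is_pseries_mult; auto.
      * apply (is_pseries_scal (K := R_AbsRing) (V := R_NormedModule)); [apply Rmult_comm|exact Hs].
    + apply (is_derive_const (K := R_AbsRing) (V := R_NormedModule) cb t).
  - intros i Hi. apply Hder.
    replace (- PSeries (A i) t ^ 2 + K * (PSeries (A 0%nat) t + cb - cb))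
      with (plus (opp (PSeries (A i) t * PSeries (A i) t)) (scal K (PSeries (A 0%nat) t)) : R).
    2: { unfold plus, opp, scal; simpl; unfold mult; simpl. ring. }
    apply (is_pseries_ext (PS_plus (PS_opp (PS_mult (A i) (A i))) (PS_scal K (A 0%nat)))).
    { intros m. destruct i as [|i]; [lia|]. reflexivity. }
    apply (is_pseries_plus (K := R_AbsRing) (V := R_NormedModule)).
    + apply (is_pseries_opp (K := R_AbsRing) (V := R_NormedModule)).
      apply is_pseries_mult; auto.
    + apply (is_pseries_scal (K := R_AbsRing) (V := R_NormedModule)); [apply Rmult_comm|apply Hps].
Qed.

(** * Continuation of bounded solutions *)

Lemma is_derive_glue (f g : R -> R) (a l : R) :
  f a = g a -> is_derive f a l -> is_derive g a l ->
  is_derive (fun t => if Rle_dec t a then f t else g t) a l.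
Proof.
  intros E Hf Hg. apply is_derive_Reals in Hf. apply is_derive_Reals in Hg.
  apply is_derive_Reals. intros e He.
  destruct (Hf e He) as [d1 H1]. destruct (Hg e He) as [d2 H2].
  assert (Hd : 0 < Rmin d1 d2) by (apply Rmin_pos; apply cond_pos).
  exists (mkposreal _ Hd). intros h Hh Hlt. simpl in Hlt.
  assert (Rabs h < d1) by (apply Rlt_le_trans with (1 := Hlt), Rmin_l).
  assert (Rabs h < d2) by (apply Rlt_le_trans with (1 := Hlt), Rmin_r).
  destruct (Rle_dec a a) as [_|Ha]; [|lra].
  destruct (Rle_dec (a + h) a); [apply H1; assumption|rewrite E; apply H2; assumption].
Qed.

(* A bounded solution is restarted close enough to [tB] by a local solution whose
   lifespan depends on the bound only. *)
Lemma bounded_sol_not_maximal (n : nat) (k cb rho0 : R) (lam0 : nat -> R) (tB : R)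
    (lam : nat -> R -> R) (rho : R -> R) (M : R) :
  (1 <= n)%nat -> 0 < k -> 0 < cb -> 0 < tB ->
  is_maximal_sol n k cb rho0 lam0 tB lam rho ->
  at_left tB (fun t => Rabs (rho t) <= M /\ forall i, (1 <= i <= n)%nat -> Rabs (lam i t) <= M) ->
  False.
Proof.
  intros Hn Hk Hcb HtB [[Hr0 [Hl0 [Hrc [Hlc Hd]]]] Hmax] Hb.
  apply at_left_iff in Hb; [|exact HtB]. destruct Hb as [t1 [Ht1 Hb]].
  assert (HM : 0 <= M).
  { apply Rle_trans with (Rabs (rho t1)); [apply Rabs_pos|apply Hb; lra]. }
  assert (HK : 0 < k / INR n).
  { apply Rdiv_lt_0_compat; [exact Hk|apply lt_0_INR; lia]. }
  (* The shifted datum [rho a - cb] is at most [M + cb]; the extra 1 keeps the bound positive. *)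
  destruct (local_existence n (k / INR n) cb (M + cb + 1)) as [d [Hdp Hloc]]; try lra.
  (* Late enough for the bound [M] to hold at [a], and close enough to [tB] for [a + d] to exceed
     it. *)
  set (a := Rmax t1 (tB - d / 2)).
  assert (Ha1 : t1 <= a) by apply Rmax_l.
  assert (Ha2 : tB - d / 2 <= a) by apply Rmax_r.
  assert (Ha3 : a < tB) by (apply Rmax_lub_lt; lra).
  destruct (Hb a ltac:(lra)) as [Hba Hbl].
  (* [local_existence] wants a bound at every index, while [lam i] is controlled for indices 1 to
     [n] only; 0 is a filler elsewhere. *)
  destruct (Hloc (fun i => if le_lt_dec i n then if le_lt_dec 1 i then lam i a else 0 else 0) (rho a))
    as [L [r [Er [EL HD]]]].
  { intros i. destruct (le_lt_dec i n); [destruct (le_lt_dec 1 i)|].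
    - assert (Rabs (lam i a) <= M) by (apply Hbl; lia). lra.
    - rewrite Rabs_R0; lra.
    - rewrite Rabs_R0; lra. }
  { unfold Rabs in *; destruct (Rcase_abs (rho a)); destruct Rcase_abs; lra. }
  assert (HL : forall i, (1 <= i <= n)%nat -> L i 0 = lam i a).
  { intros i Hi. rewrite EL by lia.
    destruct (le_lt_dec i n); [|lia]. destruct (le_lt_dec 1 i); [reflexivity|lia]. }
  set (lam' := fun i t => if Rle_dec t a then lam i t else L i (t - a)).
  set (rho' := fun t => if Rle_dec t a then rho t else r (t - a)).
  assert (Hleft : forall t, t <= a -> rho' t = rho t /\ forall i, lam' i t = lam i t).
  { intros t Ht. unfold rho', lam'. destruct (Rle_dec t a); [auto|lra]. }
  assert (Hright : forall t, a < t -> rho' t = r (t - a) /\ forall i, lam' i t = L i (t - a)).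
  { intros t Ht. unfold rho', lam'. destruct (Rle_dec t a); [lra|auto]. }
  assert (Hshift : forall (f : R -> R) t l, is_derive f (t - a) l ->
            is_derive (fun x => f (x - a)) t l).
  { intros f t l Hf. evar_last.
    - apply (is_derive_comp f (fun x => x - a)); [exact Hf|]. auto_derive; [exact I|reflexivity].
    - unfold scal; simpl; unfold mult; simpl. ring. }
  apply (Hmax (a + d)); [lra|]. exists lam', rho'.
  assert (H0 : forall t, Rabs (t - 0) < a -> t <= a).
  { intros t. unfold Rabs; destruct Rcase_abs; lra. }
  assert (Ha0 : 0 < a) by lra.
  split; [rewrite (proj1 (Hleft 0 ltac:(lra))); exact Hr0|].
  split; [intros i Hi; rewrite (proj2 (Hleft 0 ltac:(lra))); auto|].
  split.
  { rewrite (proj1 (Hleft 0 ltac:(lra))).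
    apply (filterlim_ext_loc rho); [|exact Hrc].
    exists (mkposreal a Ha0). intros t Ht _. symmetry. apply Hleft, H0, Ht. }
  split.
  { intros i Hi. rewrite (proj2 (Hleft 0 ltac:(lra))).
    apply (filterlim_ext_loc (lam i)); [|apply Hlc, Hi].
    exists (mkposreal a Ha0). intros t Ht _. symmetry. apply Hleft, H0, Ht. }
  intros t Ht.
  assert (Hsum : lam_sum n lam' t = if Rle_dec t a then lam_sum n lam t else lam_sum n L (t - a)).
  { unfold lam_sum, lam'. destruct (Rle_dec t a); reflexivity. }
  rewrite Hsum.
  destruct (Rtotal_order t a) as [Hlt|[->|Hgt]].
  - assert (Hloca : locally t (fun x => x <= a)).
    { assert (He : 0 < a - t) by lra. exists (mkposreal _ He). intros y Hy.
      change (Rabs (y - t) < a - t) in Hy. revert Hy; unfold Rabs; destruct Rcase_abs; lra. }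
    destruct (Rle_dec t a) as [_|]; [|lra].
    destruct (Hleft t ltac:(lra)) as [-> Elt].
    destruct (Hd t ltac:(lra)) as [Hdr Hdl]. split.
    + apply (is_derive_ext_loc rho); [|exact Hdr].
      revert Hloca. apply filter_imp. intros x Hx. symmetry. apply Hleft, Hx.
    + intros i Hi. rewrite Elt. apply (is_derive_ext_loc (lam i)); [|apply Hdl, Hi].
      revert Hloca. apply filter_imp. intros x Hx. symmetry. apply Hleft, Hx.
  (* At the junction both pieces have the same state, hence the same value of the vector field, so
     their derivatives agree. *)
  - destruct (Rle_dec a a) as [_|]; [|lra].
    destruct (Hleft a ltac:(lra)) as [Era Ela].
    destruct (Hd a ltac:(lra)) as [Hdr Hdl].
    destruct (HD 0 ltac:(rewrite Rabs_R0; lra)) as [HDr HDl].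
    replace 0 with (a - a) in HDr, HDl by ring. split.
    + rewrite Era. apply is_derive_glue.
      * rewrite Rminus_eq_0. symmetry; exact Er.
      * exact Hdr.
      * apply Hshift. evar_last; [exact HDr|].
        rewrite Rminus_eq_0, Er. f_equal. unfold lam_sum.
        apply sum_n_m_ext_loc. intros i Hi. apply HL, Hi.
    + intros i Hi. rewrite Era, Ela. apply is_derive_glue.
      * rewrite Rminus_eq_0. symmetry; apply HL, Hi.
      * apply Hdl, Hi.
      * apply Hshift. evar_last; [apply HDl; lia|].
        rewrite Rminus_eq_0, Er, HL by lia. reflexivity.
  - assert (Hloca : locally t (fun x => a < x)) by (apply open_gt; exact Hgt).
    destruct (Rle_dec t a) as [|_]; [lra|].
    destruct (Hright t Hgt) as [-> Ert].
    assert (Hta : Rabs (t - a) < d) by (rewrite Rabs_right; lra).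
    destruct (HD _ Hta) as [HDr HDl]. split.
    + apply (is_derive_ext_loc (fun x => r (x - a))); [|apply Hshift, HDr].
      revert Hloca. apply filter_imp. intros x Hx. symmetry. apply Hright, Hx.
    + intros i Hi. rewrite Ert. apply (is_derive_ext_loc (fun x => L i (x - a)));
        [|apply Hshift, HDl; lia].
      revert Hloca. apply filter_imp. intros x Hx. symmetry. apply Hright, Hx.
Qed.

(** * Conserved quantities *)

Lemma is_derive_sum_n_m (f df : nat -> R -> R) (t : R) (n : nat) :
  (forall i, (1 <= i <= n)%nat -> is_derive (f i) t (df i t)) ->
  is_derive (fun x => sum_n_m (fun i => f i x) 1 n) t (sum_n_m (fun i => df i t) 1 n).
Proof.
  induction n as [|n IH]; intros H.
  - rewrite sum_n_m_zero by lia.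
    apply (is_derive_ext (fun _ => zero)).
    + intros x. rewrite sum_n_m_zero by lia. reflexivity.
    + apply (is_derive_const (K := R_AbsRing) (V := R_NormedModule) zero t).
  - rewrite sum_n_Sm by lia.
    apply (is_derive_ext (fun x => plus (sum_n_m (fun i => f i x) 1 n) (f (S n) x))).
    + intros x. rewrite sum_n_Sm by lia. reflexivity.
    + apply (is_derive_plus (K := R_AbsRing) (V := R_NormedModule)).
      * apply IH. intros i Hi. apply H; lia.
      * apply H; lia.
Qed.

Lemma filterlim_sum_n_m {X : Type} (F : (X -> Prop) -> Prop) (FF : Filter F)
    (f : nat -> X -> R) (l : nat -> R) (n : nat) :
  (forall i, (1 <= i <= n)%nat -> filterlim (f i) F (locally (l i))) ->
  filterlim (fun x => sum_n_m (fun i => f i x) 1 n) F (locally (sum_n_m l 1 n)).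
Proof.
  induction n as [|n IH]; intros H.
  - rewrite sum_n_m_zero by lia.
    apply (filterlim_ext (fun _ => zero)).
    + intros x. rewrite sum_n_m_zero by lia. reflexivity.
    + apply filterlim_const.
  - rewrite sum_n_Sm by lia.
    apply (filterlim_ext (fun x => sum_n_m (fun i => f i x) 1 n + f (S n) x)).
    + intros x. rewrite sum_n_Sm by lia. reflexivity.
    + apply filterlim_Rplus; [exact FF|apply IH; intros i Hi|]; apply H; lia.
Qed.

(* [I i] stands for [ln u_i]; [flow_wronskian] is the Wronskian of [u_i] and [u_j], and
   [flow_rho] says that [rho * prod u_i] is conserved. *)
Record flow (n : nat) (k cb rho0 : R) (lam0 : nat -> R) (T : R)
    (L I : nat -> R -> R) (r : R -> R) : Prop := {
  flow_dL : forall i t, (1 <= i <= n)%nat -> 0 < t < T ->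
    is_derive (L i) t (- (L i t) ^ 2 + k / INR n * (r t - cb));
  flow_dI : forall i t, (1 <= i <= n)%nat -> 0 < t < T -> is_derive (I i) t (L i t);
  flow_wronskian : forall i j t, (1 <= i <= n)%nat -> (1 <= j <= n)%nat -> 0 < t < T ->
    (L i t - L j t) * exp (I i t) * exp (I j t) = lam0 i - lam0 j;
  flow_eq : forall i j t, (1 <= i <= n)%nat -> (1 <= j <= n)%nat -> lam0 i = lam0 j ->
    0 < t < T -> I i t = I j t;
  flow_rho : forall t, 0 < t < T -> r t = rho0 * exp (- sum_n_m (fun i => I i t) 1 n)
}.

(** In the Wronskian the common term [k / INR n * (rho t - cb)] cancels, and [- (L_i^2 - L_j^2)] is
    compensated by the logarithmic derivative [L_i + L_j] of the exponentials. A zero Wronskian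
    forces equal rates, hence equal integrals. For [rho], the factor [exp] of the sum of the [I i]
    has logarithmic derivative [lam_sum], opposite to that of [rho]. *)
Lemma flow_of_sol (n : nat) (k cb rho0 : R) (lam0 : nat -> R) (T : R)
    (lam : nat -> R -> R) (rho : R -> R) :
  0 < T -> is_sol n k cb rho0 lam0 T lam rho ->
  flow n k cb rho0 lam0 T lam (fun i t => RInt (lam i) 0 t) rho.
Proof.
  intros HT [Hr0 [Hl0 [Hrc [Hlc Hd]]]].
  set (I := fun i t => RInt (lam i) 0 t).
  assert (HI : forall i, (1 <= i <= n)%nat ->
     (forall t, 0 < t < T -> is_derive (I i) t (lam i t)) /\
     filterlim (I i) (at_right 0) (locally 0)).
  { intros i Hi. apply RInt_from_zero; [exact HT|apply Hlc, Hi|].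
    intros t Ht. apply (ex_derive_continuous (K := R_AbsRing) (V := R_NormedModule)).
    eexists. apply (proj2 (Hd t Ht)), Hi. }
  assert (HE : forall i, (1 <= i <= n)%nat ->
     filterlim (fun t => exp (I i t)) (at_right 0) (locally 1)).
  { intros i Hi. rewrite <- exp_0. apply filterlim_cont; [apply HI, Hi|].
    apply continuous_exp. }
  assert (Hw : forall i j t, (1 <= i <= n)%nat -> (1 <= j <= n)%nat -> 0 < t < T ->
    (lam i t - lam j t) * exp (I i t) * exp (I j t) = lam0 i - lam0 j).
  { intros i j t Hi Hj Ht. revert t Ht.
    apply const_of_derive; [exact HT| |].
    + intros t Ht.
      pose proof (proj2 (Hd t Ht) i Hi) as Di. pose proof (proj2 (Hd t Ht) j Hj) as Dj.
      pose proof (proj1 (HI i Hi) t Ht) as DIi. pose proof (proj1 (HI j Hj) t Ht) as DIj.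
      auto_derive.
      * repeat split; eexists; eassumption.
      * replace (Derive (fun x => lam i x) t) with (- lam i t ^ 2 + k / INR n * (rho t - cb))
          by (symmetry; apply is_derive_unique, Di).
        replace (Derive (fun x => lam j x) t) with (- lam j t ^ 2 + k / INR n * (rho t - cb))
          by (symmetry; apply is_derive_unique, Dj).
        replace (Derive (fun x => I i x) t) with (lam i t)
          by (symmetry; apply is_derive_unique, DIi).
        replace (Derive (fun x => I j x) t) with (lam j t)
          by (symmetry; apply is_derive_unique, DIj).
        ring.
    + replace (lam0 i - lam0 j) with ((lam0 i + - 1 * lam0 j) * 1 * 1) by ring.
      rewrite <- (Hl0 i Hi), <- (Hl0 j Hj).
      apply (filterlim_ext (fun t => (lam i t + - 1 * lam j t) * exp (I i t) * exp (I j t)));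
        [intros; ring|].
      repeat apply filterlim_Rmult; auto; try (apply at_right_proper_filter).
      apply filterlim_Rplus; [apply at_right_proper_filter|auto|].
      apply filterlim_Rmult; [apply at_right_proper_filter|apply filterlim_const|auto]. }
  split.
  - intros i t Hi Ht. apply (proj2 (Hd t Ht)), Hi.
  - intros i t Hi Ht. apply (proj1 (HI i Hi)), Ht.
  - exact Hw.
  - intros i j t Hi Hj Eij Ht. fold I. apply Rminus_diag_uniq. revert t Ht.
    apply (const_of_derive (fun t => I i t - I j t)); [exact HT| |].
    + intros t Ht.
      assert (E : lam i t = lam j t).
      { pose proof (Hw i j t Hi Hj Ht) as W. rewrite Eij, Rminus_eq_0 in W.
        pose proof (exp_pos (I i t)). pose proof (exp_pos (I j t)).
        apply Rmult_integral in W. destruct W as [W|W]; [|lra].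
        apply Rmult_integral in W. destruct W as [W|W]; lra. }
      replace 0 with (minus (lam i t) (lam j t) : R)
        by (rewrite E; unfold minus, plus, opp; simpl; ring).
      apply (is_derive_minus (K := R_AbsRing) (V := R_NormedModule)); apply HI; assumption.
    + replace 0 with (0 + -1 * 0) at 2 by ring.
      apply (filterlim_ext (fun t => I i t + -1 * I j t)); [intros; simpl; ring|].
      apply filterlim_Rplus; [apply at_right_proper_filter|apply HI, Hi|].
      apply filterlim_Rmult; [apply at_right_proper_filter|apply filterlim_const|apply HI, Hj].
  - fold I.
    assert (HS : forall t, 0 < t < T ->
      is_derive (fun x => sum_n_m (fun i => I i x) 1 n) t (lam_sum n lam t)).
    { intros t Ht. apply is_derive_sum_n_m. intros i Hi. apply (proj1 (HI i Hi)), Ht. }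
    assert (HS0 : filterlim (fun x => sum_n_m (fun i => I i x) 1 n) (at_right 0) (locally 0)).
    { assert (E : sum_n_m (fun _ => 0) 1 n = 0) by (rewrite sum_n_m_const; apply Rmult_0_r).
      assert (H : forall i, (1 <= i <= n)%nat -> filterlim (I i) (at_right 0) (locally 0))
        by (intros i Hi; apply HI, Hi).
      pose proof (filterlim_sum_n_m (at_right 0) _ I (fun _ => 0) n H) as Hs.
      rewrite E in Hs. exact Hs. }
    assert (Hc : forall t, 0 < t < T -> rho t * exp (sum_n_m (fun i => I i t) 1 n) = rho0).
    { apply const_of_derive; [exact HT| |].
      - intros t Ht. pose proof (proj1 (Hd t Ht)) as Dr. pose proof (HS t Ht) as DS.
        set (Sg := fun x => sum_n_m (fun i => I i x) 1 n) in *.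
        apply (is_derive_ext (fun x => rho x * exp (Sg x))); [reflexivity|].
        auto_derive.
        + repeat split; eexists; eassumption.
        + replace (Derive (fun x => rho x) t) with (- rho t * lam_sum n lam t)
            by (symmetry; apply is_derive_unique, Dr).
          replace (Derive (fun x => Sg x) t) with (lam_sum n lam t)
            by (symmetry; apply is_derive_unique, DS).
          ring.
      - replace rho0 with (rho 0 * exp 0) by (rewrite exp_0, Hr0; ring).
        apply filterlim_Rmult; [apply at_right_proper_filter|exact Hrc|].
        apply (filterlim_cont _ exp); [exact HS0|apply continuous_exp]. }
    intros t Ht. rewrite <- (Hc t Ht), Rmult_assoc, <- exp_plus, Rplus_opp_r, exp_0. ring.
Qed.

(** * Bounded and radial scenarios *)

Lemma exp_le_compat (x y : R) : x <= y -> exp x <= exp y.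
Proof. intros [H|<-]; [apply Rlt_le, exp_increasing, H|apply Rle_refl]. Qed.

Ltac derivative :=
  auto_derive;
  [ repeat split; eexists; eassumption
  | repeat match goal with
    | H : is_derive ?f ?t ?l |- context [Derive ?g ?t] =>
        replace (Derive g t) with l by (symmetry; apply is_derive_unique, H)
    end ].

Lemma sum_n_m_le_loc (a b : nat -> R) (m n : nat) :
  (forall i, (m <= i <= n)%nat -> a i <= b i) -> sum_n_m a m n <= sum_n_m b m n.
Proof.
  intros H. induction n as [|n IH].
  - destruct m as [|m]; [rewrite !sum_n_n; apply H; lia|].
    rewrite !sum_n_m_zero by lia. apply Rle_refl.
  - destruct (le_lt_dec m (S n)) as [Hm|Hm].
    + rewrite !sum_n_Sm by lia. apply Rplus_le_compat; [apply IH; intros i Hi|]; apply H; lia.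
    + rewrite !sum_n_m_zero by lia. apply Rle_refl.
Qed.

Lemma at_left_filter (T : R) : ProperFilter (at_left T).
Proof. exact (at_left_proper_filter T). Qed.

Lemma at_left_lt (T t0 : R) : t0 < T -> at_left T (fun t => t0 < t < T).
Proof.
  intros H. apply (at_left_of T ((t0 + T) / 2)); [lra|]. intros t Ht. lra.
Qed.

Lemma at_left_exists (T t0 : R) (Q : R -> Prop) :
  t0 < T -> at_left T Q -> exists t, t0 < t < T /\ Q t.
Proof.
  intros H0 HQ.
  assert (H := filter_and _ _ (at_left_lt T t0 H0) HQ).
  destruct (filter_ex _ H) as [t [H1 H2]]. exists t; auto.
Qed.

(** The Wronskian keeps its initial sign and differs from [L i t - L j t] by a positive factor. *)
Lemma flow_order (n : nat) (k cb rho0 : R) (lam0 : nat -> R) (T : R)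
    (L I : nat -> R -> R) (r : R -> R) (i j : nat) (t : R) :
  flow n k cb rho0 lam0 T L I r -> (1 <= i <= n)%nat -> (1 <= j <= n)%nat ->
  0 < t < T -> lam0 i <= lam0 j -> L i t <= L j t.
Proof.
  intros H Hi Hj Ht Hij.
  pose proof (flow_wronskian _ _ _ _ _ _ _ _ _ H i j t Hi Hj Ht) as W.
  pose proof (exp_pos (I i t)). pose proof (exp_pos (I j t)).
  assert (0 < exp (I i t) * exp (I j t)) by (apply Rmult_lt_0_compat; assumption).
  rewrite Rmult_assoc in W. nra.
Qed.

(** Once |P'| < 1, a value at least [e] taken within [e / 4] of [T] leaves P above [e / 2] until
    [T]. So either such values exist for some [e], or P tends to 0. *)
Lemma vanish_or_bounded_below (P y : R -> R) (T : R) :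
  0 < T -> (forall t, 0 < t < T -> 0 < P t) ->
  (forall t, 0 < t < T -> is_derive P t (y t)) ->
  filterlim y (at_left T) (locally 0) ->
  filterlim P (at_left T) (locally 0) \/ exists d, 0 < d /\ at_left T (fun t => d <= P t).
Proof.
  intros HT HP Hd Hy.
  destruct (classic (exists d, 0 < d /\ at_left T (fun t => d <= P t)))
    as [Hyes|Hno]; [right; exact Hyes|left].
  apply filterlim_eps; [apply at_left_filter|]. intros e He.
  assert (Hy1 := proj1 (filterlim_eps (at_left T) _ y 0) Hy 1 Rlt_0_1).
  apply at_left_iff in Hy1; [|exact HT]. destruct Hy1 as [t0 [Ht0 Hy1]].
  apply (at_left_of T (Rmax t0 (T - e / 4))); [apply Rmax_lub_lt; lra|].
  intros t Ht.
  assert (t0 <= t) by (eapply Rle_trans; [apply Rmax_l|apply Ht]).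
  assert (T - e / 4 <= t) by (eapply Rle_trans; [apply Rmax_r|apply Ht]).
  rewrite Rminus_0_r, Rabs_right by (apply Rle_ge, Rlt_le, HP; lra).
  apply Rnot_le_lt. intros Hle. apply Hno. exists (e / 2). split; [lra|].
  apply (at_left_of T t); [lra|]. intros s Hs.
  assert (P t + t <= P s + s); [|lra].
  apply (increasing_of_derive (fun s => P s + s) (fun s => y s + 1) t T); try lra.
  - intros u Hu. apply (is_derive_plus (K := R_AbsRing) (V := R_NormedModule) P (fun s => s)).
    + apply Hd; lra.
    + apply (is_derive_id (K := R_AbsRing)).
  - intros u Hu. specialize (Hy1 u ltac:(lra)).
    rewrite Rminus_0_r in Hy1. revert Hy1. unfold Rabs; destruct Rcase_abs; lra.
Qed.

(** Dividing the convergent products by P >= d bounds the two extreme rates, and the preserved order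
    squeezes all the others between them. Then the sum of the [I i] decreases at most linearly over
    a finite time, which bounds [r] and contradicts maximality. *)
Lemma not_maximal_of_lower_bound (n : nat) (k cb rho0 : R) (lam0 : nat -> R) (T : R)
    (L I : nat -> R -> R) (r : R -> R) (d p q : R) :
  (1 <= n)%nat -> 0 < k -> 0 < cb -> 0 < rho0 -> 0 < T ->
  (forall i, (1 <= i <= n)%nat -> lam0 1%nat <= lam0 i <= lam0 n) ->
  is_maximal_sol n k cb rho0 lam0 T L r ->
  flow n k cb rho0 lam0 T L I r ->
  filterlim (fun t => L 1%nat t * exp (I 1%nat t + I n t)) (at_left T) (locally p) ->
  filterlim (fun t => L n t * exp (I 1%nat t + I n t)) (at_left T) (locally q) ->
  0 < d -> at_left T (fun t => d <= exp (I 1%nat t + I n t)) -> False.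
Proof.
  intros Hn Hk Hcb Hrho HT Hord Hmax H Ha Hb Hd HP.
  assert (Ha1 := proj1 (filterlim_eps (at_left T) _ _ _) Ha 1 Rlt_0_1).
  assert (Hb1 := proj1 (filterlim_eps (at_left T) _ _ _) Hb 1 Rlt_0_1).
  assert (Hall := filter_and _ _ HP (filter_and _ _ Ha1 Hb1)).
  apply at_left_iff in Hall; [|exact HT]. destruct Hall as [t0 [Ht0 Hall]].
  set (M := (Rabs p + Rabs q + 1) / d).
  assert (HMd : M * d = Rabs p + Rabs q + 1) by (unfold M; field; lra).
  pose proof (Rabs_pos p) as Hp0. pose proof (Rabs_pos q) as Hq0.
  assert (HM : 0 < M) by (unfold M; apply Rdiv_lt_0_compat; lra).
  assert (Hend : forall l P v, d <= P -> Rabs (l * P - v) < 1 -> Rabs v <= Rabs p + Rabs q ->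
            Rabs l <= M).
  { intros l P v HdP Hl Hv. apply Rmult_le_reg_r with P; [lra|].
    rewrite <- (Rabs_right P) at 1 by lra. rewrite <- Rabs_mult.
    apply Rle_trans with (M * d); [|apply Rmult_le_compat_l; lra].
    rewrite HMd. replace (l * P) with ((l * P - v) + v) by ring.
    apply Rle_trans with (1 := Rabs_triang _ _). lra. }
  assert (HL : forall t, t0 <= t < T -> forall i, (1 <= i <= n)%nat -> Rabs (L i t) <= M).
  { intros t Ht i Hi. destruct (Hall t Ht) as [H1 [H2 H3]].
    assert (Rabs (L 1%nat t) <= M) by (apply (Hend _ _ _ H1 H2); lra).
    assert (Rabs (L n t) <= M) by (apply (Hend _ _ _ H1 H3); lra).
    assert (L 1%nat t <= L i t) by (apply (flow_order _ _ _ _ _ _ _ _ _ _ _ t H); [lia|lia|lra|apply Hord, Hi]).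
    assert (L i t <= L n t) by (apply (flow_order _ _ _ _ _ _ _ _ _ _ _ t H); [lia|lia|lra|apply Hord, Hi]).
    unfold Rabs in *; repeat destruct Rcase_abs; lra. }
  set (S := fun t => sum_n_m (fun i => I i t) 1 n).
  assert (HS : forall t, t0 <= t < T -> S t0 - INR n * M * (t - t0) <= S t).
  { intros t Ht.
    assert (S t0 + INR n * M * t0 <= S t + INR n * M * t); [|lra].
    apply (increasing_of_derive (fun s => S s + INR n * M * s)
             (fun s => sum_n_m (fun i => L i s) 1 n + INR n * M) t0 T); try lra.
    - intros s Hs. apply (is_derive_plus (K := R_AbsRing) (V := R_NormedModule) S).
      + apply is_derive_sum_n_m. intros i Hi. eapply flow_dI; eauto; lra.
      + auto_derive; [exact Logic.I|ring].
    - intros s Hs.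
      assert (sum_n_m (fun _ => - M) 1 n <= sum_n_m (fun i => L i s) 1 n).
      { apply sum_n_m_le_loc. intros i Hi. specialize (HL s Hs i Hi).
        revert HL; unfold Rabs; destruct Rcase_abs; lra. }
      rewrite sum_n_m_const in H0. replace (Datatypes.S n - 1)%nat with n in H0 by lia. lra. }
  apply (bounded_sol_not_maximal n k cb rho0 lam0 T L r
           (M + rho0 * exp (- (S t0 - INR n * M * (T - t0))))); auto.
  pose proof (exp_pos (- (S t0 - INR n * M * (T - t0)))) as Hexp.
  assert (0 < rho0 * exp (- (S t0 - INR n * M * (T - t0)))) by (apply Rmult_lt_0_compat; lra).
  apply (at_left_of T t0); [lra|]. intros t Ht. split.
  - rewrite (flow_rho _ _ _ _ _ _ _ _ _ H) by lra.
    rewrite Rabs_right by (apply Rle_ge, Rmult_le_pos; [lra|apply Rlt_le, exp_pos]).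
    assert (exp (- S t) <= exp (- (S t0 - INR n * M * (T - t0)))).
    { apply exp_le_compat. specialize (HS t Ht).
      assert (0 <= INR n * M * (T - t)) by (apply Rmult_le_pos; [apply Rmult_le_pos; [apply pos_INR|lra]|lra]).
      lra. }
    fold (S t). nra.
  - intros i Hi. specialize (HL t Ht i Hi). lra.
Qed.

(* Energy of [u'' = (k/n)(rho0 u^(1-n) - cb u)] with the repulsive potential replaced by
   [- ln u], which it dominates when [u < 1] since [n >= 2]. *)
Lemma no_radial_collapse (n : nat) (k cb rho0 : R) (lam0 : nat -> R) (T : R)
    (L I : nat -> R -> R) (r : R -> R) :
  (2 <= n)%nat -> 0 < k -> 0 < cb -> 0 < rho0 -> 0 < T ->
  (forall i, (1 <= i <= n)%nat -> lam0 i = lam0 1%nat) ->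
  flow n k cb rho0 lam0 T L I r ->
  (forall m, at_left T (fun t => I 1%nat t < m)) -> False.
Proof.
  intros Hn Hk Hcb Hrho HT Heq H Hinf.
  set (K := k / INR n).
  assert (Hn2 : 2 <= INR n) by (change 2 with (INR 2); apply le_INR, Hn).
  assert (HK : 0 < K) by (unfold K; apply Rdiv_lt_0_compat; lra).
  assert (Hr : forall t, 0 < t < T -> r t = rho0 * exp (- (INR n * I 1%nat t))).
  { intros t Ht. rewrite (flow_rho _ _ _ _ _ _ _ _ _ H t Ht). do 3 f_equal.
    rewrite (sum_n_m_ext_loc _ (fun _ => I 1%nat t)).
    - rewrite sum_n_m_const. do 2 f_equal. lia.
    - intros i Hi. apply (flow_eq _ _ _ _ _ _ _ _ _ H); [lia|lia|apply Heq, Hi|exact Ht]. }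
  set (l := L 1%nat). set (u := I 1%nat).
  assert (Hl : forall t, 0 < t < T -> is_derive l t (- (l t) ^ 2 + K * (r t - cb)))
    by (intros t Ht; apply (flow_dL _ _ _ _ _ _ _ _ _ H); [lia|exact Ht]).
  assert (Hu : forall t, 0 < t < T -> is_derive u t (l t))
    by (intros t Ht; apply (flow_dI _ _ _ _ _ _ _ _ _ H); [lia|exact Ht]).
  (* The threshold 0 gives [u < 0], hence [exp (- n u) >= exp (- u) >= 1 - u]; the threshold
     [1 - cb / rho0] then makes [r] exceed [cb]. *)
  assert (Hev := filter_and _ _ (Hinf 0) (Hinf (1 - cb / rho0))).
  apply at_left_iff in Hev; [|exact HT]. destruct Hev as [t0 [Ht0 Hev]].
  assert (Hrc : forall t, t0 <= t < T -> cb < r t).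
  { intros t Ht. destruct (Hev t Ht) as [H1 H2]. fold u in H1, H2.
    rewrite Hr by lra. fold u.
    apply Rlt_le_trans with (rho0 * (1 + - u t)).
    - apply Rmult_lt_reg_r with (/ rho0); [apply Rinv_0_lt_compat, Hrho|].
      replace (rho0 * (1 + - u t) * / rho0) with (1 - u t) by (field; lra).
      unfold Rdiv in H2. lra.
    - apply Rmult_le_compat_l; [lra|].
      apply Rle_trans with (1 := exp_ineq1_le _). apply exp_le_compat. nra. }
  (* [l * exp u] is the derivative of u_1, which is convex once [r > cb]. *)
  assert (Hmono : forall s t, t0 <= s -> s <= t -> t < T -> l s * exp (u s) <= l t * exp (u t)).
  { apply (increasing_of_derive (fun t => l t * exp (u t)) (fun t => K * (r t - cb) * exp (u t))).
    - intros t Ht. assert (D1 := Hl t ltac:(lra)). assert (D2 := Hu t ltac:(lra)).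
      derivative. ring.
    - intros t Ht. specialize (Hrc t Ht). pose proof (exp_pos (u t)).
      apply Rmult_le_pos; [apply Rmult_le_pos|]; lra. }
  (* A nonnegative slope would persist by convexity, and [u] could no longer tend to minus
     infinity. *)
  assert (Hneg : forall t, t0 <= t < T -> l t < 0).
  { intros t1 Ht1. apply Rnot_le_lt. intros Hpos.
    destruct (at_left_exists T t1 _ (proj2 Ht1) (Hinf (u t1))) as [t [Ht Hlt]].
    assert (u t1 <= u t); [|fold u in Hlt; lra].
    apply (increasing_of_derive u l t1 T); try lra.
    - intros s Hs. apply Hu; lra.
    - intros s Hs. specialize (Hmono t1 s ltac:(lra) ltac:(lra) ltac:(lra)).
      pose proof (exp_pos (u t1)). pose proof (exp_pos (u s)).
      assert (0 <= l t1 * exp (u t1)) by (apply Rmult_le_pos; lra).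
      apply Rmult_le_reg_r with (exp (u s)); lra. }
  (* Its derivative is [K l (r exp (2 u) - rho0)], nonpositive since [l < 0] and [r exp (2 u) = rho0
     exp ((2 - n) u) >= rho0]. Two of its terms are nonnegative, while [- K rho0 u] is unbounded
     above. *)
  set (G := fun t => exp (2 * u t) * (l t) ^ 2 / 2 + K / 2 * cb * exp (2 * u t) - K * rho0 * u t).
  assert (HG : forall t, t0 <= t -> t < T -> - G t0 <= - G t).
  { intros t Ht HtT.
    apply (increasing_of_derive (fun t => - G t)
             (fun t => - (K * l t * (r t * exp (2 * u t) - rho0))) t0 T); try lra.
    - intros s Hs. assert (D1 := Hl s ltac:(lra)). assert (D2 := Hu s ltac:(lra)).
      unfold G. derivative. field.
    - intros s Hs. specialize (Hneg s Hs). destruct (Hev s Hs) as [Hus _]. fold u in Hus.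
      assert (rho0 <= r s * exp (2 * u s)).
      { rewrite Hr by lra. fold u. rewrite Rmult_assoc, <- exp_plus.
        rewrite <- (Rmult_1_r rho0) at 1. apply Rmult_le_compat_l; [lra|].
        rewrite <- exp_0. apply exp_le_compat. nra. }
      assert (0 <= K * - l s * (r s * exp (2 * u s) - rho0)); [|lra].
      apply Rmult_le_pos; [apply Rmult_le_pos|]; lra. }
  assert (HKr : 0 < K * rho0) by (apply Rmult_lt_0_compat; lra).
  destruct (at_left_exists T t0 _ (proj2 Ht0) (Hinf (- G t0 / (K * rho0)))) as [t [Ht Hlt]].
  fold u in Hlt. specialize (HG t ltac:(lra) ltac:(lra)).
  assert (K * rho0 * u t < - G t0).
  { apply Rmult_lt_compat_l with (r := K * rho0) in Hlt; [|exact HKr].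
    replace (K * rho0 * (- G t0 / (K * rho0))) with (- G t0) in Hlt by (field; lra). exact Hlt. }
  unfold G at 2 in HG.
  assert (0 <= exp (2 * u t) * l t ^ 2 / 2).
  { pose proof (exp_pos (2 * u t)). pose proof (pow2_ge_0 (l t)).
    apply Rmult_le_pos; [apply Rmult_le_pos|]; lra. }
  assert (0 <= K / 2 * cb * exp (2 * u t)).
  { pose proof (exp_pos (2 * u t)). apply Rmult_le_pos; [apply Rmult_le_pos|]; lra. }
  lra.
Qed.

(** * Limits of monotone functions and linear decay at the end time *)

Lemma decreasing_limit (f : R -> R) (t0 T m : R) :
  t0 < T -> (forall s t, t0 <= s -> s <= t -> t < T -> f t <= f s) ->
  (forall t, t0 <= t < T -> m <= f t) ->
  exists l, filterlim f (at_left T) (locally l) /\ forall t, t0 <= t < T -> l <= f t.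
Proof.
  intros HT Hdec Hm.
  destruct (completeness (fun x => exists t, t0 <= t < T /\ x = - f t)) as [l [Hub Hlub]].
  - exists (- m). intros x [t [Ht ->]]. specialize (Hm t Ht). lra.
  - exists (- f t0), t0. split; [lra|reflexivity].
  - exists (- l). split.
    + apply filterlim_eps; [apply at_left_filter|]. intros e He.
      destruct (classic (exists t, t0 <= t < T /\ f t < - l + e)) as [[t1 [Ht1 Hf]]|Hno].
      * apply (at_left_of T t1); [lra|]. intros t Ht.
        assert (f t <= f t1) by (apply Hdec; lra).
        assert (- f t <= l) by (apply Hub; exists t; split; [lra|reflexivity]).
        unfold Rabs; destruct Rcase_abs; lra.
      * exfalso. assert (l <= l - e); [|lra]. apply Hlub. intros x [t [Ht ->]].
        destruct (Rlt_le_dec (f t) (- l + e)); [exfalso; apply Hno; exists t; auto|lra].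
    + intros t Ht. assert (- f t <= l) by (apply Hub; exists t; auto). lra.
Qed.

Lemma nonpos_of_increasing_to_zero (g : R -> R) (t0 T : R) :
  (forall s t, t0 <= s -> s <= t -> t < T -> g s <= g t) ->
  filterlim g (at_left T) (locally 0) ->
  forall t, t0 <= t < T -> g t <= 0.
Proof.
  intros Hinc Hg t Ht. apply Rnot_lt_le. intros Hpos.
  pose proof (proj1 (filterlim_eps (at_left T) _ g 0) Hg (g t) Hpos) as Hev.
  destruct (at_left_exists T t _ (proj2 Ht) Hev) as [s [Hs Hlt]].
  specialize (Hinc t s ltac:(lra) ltac:(lra) ltac:(lra)).
  revert Hlt. unfold Rabs; destruct Rcase_abs; lra.
Qed.

Lemma filterlim_time_left (T : R) : filterlim (fun t => T - t) (at_left T) (locally 0).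
Proof.
  apply filterlim_eps; [apply at_left_filter|]. intros e He.
  apply (at_left_of T (T - e / 2)); [lra|]. intros t Ht.
  unfold Rabs; destruct Rcase_abs; lra.
Qed.

(** A one-sided l'Hopital rule: for each slope slightly off [c], the difference between [S] and the
    line of that slope through zero at [T] is monotone with limit 0, so its sign is known. *)
Lemma linear_decay (S dS : R -> R) (c T : R) :
  0 < T -> (forall t, 0 < t < T -> is_derive S t (dS t)) ->
  filterlim dS (at_left T) (locally (- c)) -> filterlim S (at_left T) (locally 0) ->
  filterlim (fun t => S t / (T - t)) (at_left T) (locally c).
Proof.
  intros HT Hd HdS HS. apply filterlim_eps; [apply at_left_filter|]. intros e He.
  pose proof (proj1 (filterlim_eps (at_left T) _ _ _) HdS (e / 2) ltac:(lra)) as Hev.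
  apply at_left_iff in Hev; [|exact HT]. destruct Hev as [t0 [Ht0 Hev]].
  assert (Hlin : forall a b, filterlim (fun t => a * S t + b * (T - t)) (at_left T) (locally 0)).
  { intros a b. replace 0 with (a * 0 + b * 0) by ring.
    apply filterlim_Rplus; [apply at_left_filter| |];
      (apply filterlim_Rmult; [apply at_left_filter|apply filterlim_const|]).
    - exact HS.
    - apply filterlim_time_left. }
  assert (Hsgn : forall a b, (forall t, t0 <= t < T -> 0 <= a * dS t - b) ->
            forall t, t0 <= t < T -> a * S t + b * (T - t) <= 0).
  { intros a b Hab. apply nonpos_of_increasing_to_zero; [|apply Hlin].
    apply (increasing_of_derive _ (fun t => a * dS t - b)); [|exact Hab].
    intros t Ht. assert (D := Hd t ltac:(lra)). derivative. ring. }
  apply (at_left_of T t0); [lra|]. intros t Ht.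
  assert (H1 : 1 * S t + - (c + e / 2) * (T - t) <= 0).
  { apply Hsgn; [|exact Ht]. intros s Hs. specialize (Hev s Hs).
    revert Hev. unfold Rabs; destruct Rcase_abs; lra. }
  assert (H2 : -1 * S t + (c - e / 2) * (T - t) <= 0).
  { apply Hsgn; [|exact Ht]. intros s Hs. specialize (Hev s Hs).
    revert Hev. unfold Rabs; destruct Rcase_abs; lra. }
  assert (Hq : c - e / 2 <= S t / (T - t) <= c + e / 2).
  { split; apply Rmult_le_reg_r with (T - t); try lra; unfold Rdiv;
      rewrite Rmult_assoc, Rinv_l by lra; lra. }
  unfold Rabs; destruct Rcase_abs; lra.
Qed.

(** * Collapse with distinct initial rates *)

(** The u_i solve one linear second-order equation, so each is a combination of u_1 and u_n. The
    coefficients are Wronskians, and the relation is an algebraic identity between the three of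
    them. *)
Lemma flow_combination (n : nat) (k cb rho0 : R) (lam0 : nat -> R) (T : R)
    (L I : nat -> R -> R) (r : R -> R) (i : nat) (t : R) :
  (1 <= n)%nat -> flow n k cb rho0 lam0 T L I r -> (1 <= i <= n)%nat -> 0 < t < T ->
  (lam0 n - lam0 1%nat) * exp (I i t) =
  (lam0 n - lam0 i) * exp (I 1%nat t) + (lam0 i - lam0 1%nat) * exp (I n t).
Proof.
  intros Hn H Hi Ht.
  rewrite <- (flow_wronskian _ _ _ _ _ _ _ _ _ H n 1%nat t) by (try lia; lra).
  rewrite <- (flow_wronskian _ _ _ _ _ _ _ _ _ H n i t) by (try lia; lra).
  rewrite <- (flow_wronskian _ _ _ _ _ _ _ _ _ H i 1%nat t) by (try lia; lra).
  ring.
Qed.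

(** Comparison with a clock [x]: eventually [f - c x] is nondecreasing, and [x] runs to infinity. *)
Lemma unbounded_of_derive_ge (f df x w : R -> R) (c T : R) :
  0 < T -> 0 < c ->
  (forall t, 0 < t < T -> is_derive f t (df t)) ->
  (forall t, 0 < t < T -> is_derive x t (w t)) ->
  at_left T (fun t => c * w t <= df t) ->
  (forall M, at_left T (fun t => M < x t)) ->
  forall M, at_left T (fun t => M < f t).
Proof.
  intros HT Hc Hf Hx Hge Hinf M.
  apply at_left_iff in Hge; [|exact HT]. destruct Hge as [t0 [Ht0 Hge]].
  assert (Hev := filter_and _ _ (at_left_lt T t0 (proj2 Ht0))
                   (Hinf ((M - f t0 + c * x t0) / c))).
  revert Hev. apply filter_imp. intros t [Ht Hxt].
  assert (f t0 - c * x t0 <= f t - c * x t).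
  { apply (increasing_of_derive (fun t => f t - c * x t) (fun t => df t - c * w t) t0 T); try lra.
    - intros s Hs. assert (D1 := Hf s ltac:(lra)). assert (D2 := Hx s ltac:(lra)).
      derivative. ring.
    - intros s Hs. specialize (Hge s Hs). lra. }
  apply Rmult_lt_compat_l with (r := c) in Hxt; [|exact Hc].
  replace (c * ((M - f t0 + c * x t0) / c)) with (M - f t0 + c * x t0) in Hxt by (field; lra).
  lra.
Qed.

(** What is left once P is known to vanish and the initial rates differ. The limits in [col_a] and
    [col_b] are the values forced by [p = q] and [p + q = mu]. *)
Record collapsing (n : nat) (k cb rho0 : R) (lam0 : nat -> R) (T : R)
    (L I : nat -> R -> R) (r : R -> R) : Prop := {
  col_n : (2 <= n)%nat;
  col_k : 0 < k;
  col_cb : 0 < cb;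
  col_rho0 : 0 < rho0;
  col_T : 0 < T;
  col_flow : flow n k cb rho0 lam0 T L I r;
  col_mu : lam0 1%nat < lam0 n;
  col_a : filterlim (fun t => L 1%nat t * exp (I 1%nat t + I n t)) (at_left T)
            (locally (- ((lam0 n - lam0 1%nat) / 2)));
  col_b : filterlim (fun t => L n t * exp (I 1%nat t + I n t)) (at_left T)
            (locally ((lam0 n - lam0 1%nat) / 2));
  col_P : filterlim (fun t => exp (I 1%nat t + I n t)) (at_left T) (locally 0)
}.

Section Collapse.

Context (n : nat) (k cb rho0 : R) (lam0 : nat -> R) (T : R)
    (L I : nat -> R -> R) (r : R -> R) (H : collapsing n k cb rho0 lam0 T L I r).

Let mu := lam0 n - lam0 1%nat.
Let P t := exp (I 1%nat t + I n t).
Let HT : 0 < T := col_T _ _ _ _ _ _ _ _ _ H.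
Let Hflow := col_flow _ _ _ _ _ _ _ _ _ H.

Lemma col_mu_pos : 0 < mu.
Proof. pose proof (col_mu _ _ _ _ _ _ _ _ _ H). unfold mu. lra. Qed.

Lemma col_dI1 (t : R) : 0 < t < T -> is_derive (I 1%nat) t (L 1%nat t).
Proof. pose proof (col_n _ _ _ _ _ _ _ _ _ H). apply (flow_dI _ _ _ _ _ _ _ _ _ Hflow); lia. Qed.

Lemma col_dIn (t : R) : 0 < t < T -> is_derive (I n) t (L n t).
Proof. pose proof (col_n _ _ _ _ _ _ _ _ _ H). apply (flow_dI _ _ _ _ _ _ _ _ _ Hflow); lia. Qed.

Lemma col_dL1 (t : R) : 0 < t < T ->
  is_derive (L 1%nat) t (- (L 1%nat t) ^ 2 + k / INR n * (r t - cb)).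
Proof. pose proof (col_n _ _ _ _ _ _ _ _ _ H). apply (flow_dL _ _ _ _ _ _ _ _ _ Hflow); lia. Qed.

Lemma col_dLn (t : R) : 0 < t < T ->
  is_derive (L n) t (- (L n t) ^ 2 + k / INR n * (r t - cb)).
Proof. pose proof (col_n _ _ _ _ _ _ _ _ _ H). apply (flow_dL _ _ _ _ _ _ _ _ _ Hflow); lia. Qed.

Lemma col_wronskian (t : R) : 0 < t < T -> L n t - L 1%nat t = mu / P t.
Proof.
  intros Ht. pose proof (col_n _ _ _ _ _ _ _ _ _ H).
  pose proof (flow_wronskian _ _ _ _ _ _ _ _ _ Hflow n 1%nat t ltac:(lia) ltac:(lia) Ht) as W.
  unfold mu, P. rewrite <- W, exp_plus. field.
  split; apply Rgt_not_eq, exp_pos.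
Qed.

(** The product [L n t * P t] tends to [mu / 2 > 0], so u_n eventually increases. This drives the
    clock to infinity, since [I n - I 1] equals [2 I n - ln P]. *)
Lemma col_In_bounded_below : exists m, at_left T (fun t => m <= I n t).
Proof.
  pose proof col_mu_pos as Hmu.
  assert (Hb := proj1 (filterlim_eps (at_left T) _ _ _) (col_b _ _ _ _ _ _ _ _ _ H) (mu / 2) ltac:(lra)).
  apply at_left_iff in Hb; [|exact HT]. destruct Hb as [t0 [Ht0 Hb]].
  exists (I n t0). apply (at_left_of T t0); [lra|]. intros t Ht.
  apply (increasing_of_derive (I n) (L n) t0 T); try lra.
  - intros s Hs. apply col_dIn; lra.
  - intros s Hs. specialize (Hb s Hs). fold mu in Hb. fold (P s) in Hb.
    assert (0 < P s) by apply exp_pos.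
    assert (0 < L n s * P s) by (revert Hb; unfold Rabs; destruct Rcase_abs; lra).
    apply Rlt_le. apply Rmult_lt_reg_r with (P s); lra.
Qed.

Lemma col_lnP_to_minus_infty (m : R) : at_left T (fun t => I 1%nat t + I n t < m).
Proof.
  assert (Hp := proj1 (filterlim_eps (at_left T) _ _ _) (col_P _ _ _ _ _ _ _ _ _ H) (exp m) (exp_pos m)).
  revert Hp. apply filter_imp. intros t Ht.
  rewrite Rminus_0_r, Rabs_right in Ht by apply Rle_ge, Rlt_le, exp_pos.
  apply exp_lt_inv, Ht.
Qed.

Lemma col_gap_to_infty (M : R) : at_left T (fun t => M < I n t - I 1%nat t).
Proof.
  destruct col_In_bounded_below as [m Hm].
  assert (Hev := filter_and _ _ Hm (col_lnP_to_minus_infty (2 * m - M))).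
  revert Hev. apply filter_imp. intros t [H1 H2]. lra.
Qed.

Lemma col_dgap (t : R) : 0 < t < T -> is_derive (fun s => I n s - I 1%nat s) t (mu / P t).
Proof.
  intros Ht. rewrite <- col_wronskian by exact Ht.
  apply (is_derive_minus (K := R_AbsRing) (V := R_NormedModule)); [apply col_dIn|apply col_dI1]; exact Ht.
Qed.

(** * The derivative y of P against the clock *)

Let y t := (L 1%nat t + L n t) * P t.
(* [E = P P''] *)
Let E t := 2 * (k / INR n) * (r t * P t ^ 2) - 2 * (k / INR n) * cb * P t ^ 2
           + 2 * (L 1%nat t * P t) * (L n t * P t).

Lemma col_dy (t : R) : 0 < t < T -> is_derive y t (E t / P t).
Proof.
  intros Ht.
  assert (D1 := col_dI1 t Ht). assert (D2 := col_dIn t Ht).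
  assert (D3 := col_dL1 t Ht). assert (D4 := col_dLn t Ht).
  unfold y, E, P. set (K := k / INR n) in *. derivative.
  field. apply Rgt_not_eq, exp_pos.
Qed.

Lemma col_y_lim : filterlim y (at_left T) (locally 0).
Proof.
  replace 0 with (- (mu / 2) + mu / 2) by ring.
  apply (filterlim_ext (fun t => L 1%nat t * P t + L n t * P t)).
  - intros t. unfold y. ring.
  - apply filterlim_Rplus; [apply at_left_filter|apply (col_a _ _ _ _ _ _ _ _ _ H)
                           |apply (col_b _ _ _ _ _ _ _ _ _ H)].
Qed.

(** Since [y' = E / P] and the clock advances at speed [mu / P], the slope of [y] against the clock
    is [E / mu]. A positive lower bound would send [y] to infinity, whereas [y] tends to 0. *)
Lemma col_drift_pos (c : R) : 0 < c -> at_left T (fun t => c <= E t) -> False.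
Proof.
  intros Hc HE. pose proof col_mu_pos as Hmu.
  assert (Hy := unbounded_of_derive_ge y (fun t => E t / P t) (fun s => I n s - I 1%nat s)
                 (fun t => mu / P t) (c / mu) T HT ltac:(apply Rdiv_lt_0_compat; lra)
                 col_dy col_dgap).
  assert (HE' : at_left T (fun t => c / mu * (mu / P t) <= E t / P t)).
  { revert HE. apply filter_imp. intros t Ht.
    replace (c / mu * (mu / P t)) with (c * / P t) by (field; split; [apply Rgt_not_eq, exp_pos|lra]).
    apply Rmult_le_compat_r; [apply Rlt_le, Rinv_0_lt_compat, exp_pos|exact Ht]. }
  pose proof (proj1 (filterlim_eps (at_left T) _ _ _) col_y_lim 1 Rlt_0_1) as Hy1.
  assert (Hev := filter_and _ _ (Hy HE' col_gap_to_infty 1) Hy1).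
  destruct (filter_ex _ Hev) as [t [H1 H2]].
  rewrite Rminus_0_r in H2. revert H2; unfold Rabs; destruct Rcase_abs; lra.
Qed.

Lemma col_drift_neg (c : R) : 0 < c -> at_left T (fun t => E t <= - c) -> False.
Proof.
  intros Hc HE. pose proof col_mu_pos as Hmu.
  assert (Hy := unbounded_of_derive_ge (fun t => - y t) (fun t => - (E t / P t))
                 (fun s => I n s - I 1%nat s)
                 (fun t => mu / P t) (c / mu) T HT ltac:(apply Rdiv_lt_0_compat; lra)
                 (fun t Ht => is_derive_opp (K := R_AbsRing) (V := R_NormedModule) y t _ (col_dy t Ht)) col_dgap).
  assert (HE' : at_left T (fun t => c / mu * (mu / P t) <= - (E t / P t))).
  { revert HE. apply filter_imp. intros t Ht.
    replace (c / mu * (mu / P t)) with (c * / P t) by (field; split; [apply Rgt_not_eq, exp_pos|lra]).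
    replace (- (E t / P t)) with (- E t * / P t) by (unfold Rdiv; ring).
    apply Rmult_le_compat_r; [apply Rlt_le, Rinv_0_lt_compat, exp_pos|lra]. }
  pose proof (proj1 (filterlim_eps (at_left T) _ _ _) col_y_lim 1 Rlt_0_1) as Hy1.
  assert (Hev := filter_and _ _ (Hy HE' col_gap_to_infty 1) Hy1).
  destruct (filter_ex _ Hev) as [t [H1 H2]].
  rewrite Rminus_0_r in H2. revert H2; unfold Rabs; destruct Rcase_abs; lra.
Qed.

Lemma col_ab_lim :
  filterlim (fun t => 2 * (L 1%nat t * P t) * (L n t * P t)) (at_left T) (locally (- (mu ^ 2 / 2))).
Proof.
  replace (- (mu ^ 2 / 2)) with (2 * - (mu / 2) * (mu / 2)) by field.
  apply filterlim_Rmult; [apply at_left_filter| |apply (col_b _ _ _ _ _ _ _ _ _ H)].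
  apply filterlim_Rmult; [apply at_left_filter|apply filterlim_const|].
  apply (col_a _ _ _ _ _ _ _ _ _ H).
Qed.

Lemma col_P2_lim (c : R) : filterlim (fun t => c * P t ^ 2) (at_left T) (locally 0).
Proof.
  replace 0 with (c * (0 * 0)) by ring.
  apply (filterlim_ext (fun t => c * (P t * P t))); [intros; ring|].
  repeat apply filterlim_Rmult; try apply at_left_filter; try apply (col_P _ _ _ _ _ _ _ _ _ H).
  apply filterlim_const.
Qed.

Lemma col_rP2 (t : R) : 0 < t < T ->
  r t * P t ^ 2 = rho0 * exp (2 * (I 1%nat t + I n t) - sum_n_m (fun i => I i t) 1 n).
Proof.
  intros Ht. rewrite (flow_rho _ _ _ _ _ _ _ _ _ Hflow) by exact Ht.
  unfold P, Rminus. rewrite !exp_plus.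
  replace (2 * (I 1%nat t + I n t)) with ((I 1%nat t + I n t) + (I 1%nat t + I n t)) by ring.
  rewrite !exp_plus. ring.
Qed.


(** * Size of rho P^2 and the values of J and n *)

(** For [i > J] the coefficient of u_n in u_i is at least [s > 0], and u_1 <= u_n at late times, so
    u_i lies between [s u_n] and u_n. Taking logarithms costs [- ln s] per index, on the lower side
    only. *)
Lemma col_sum_bounds (J : nat) :
  (1 <= J < n)%nat -> (forall i, (1 <= i <= J)%nat -> lam0 i = lam0 1%nat) ->
  lam0 1%nat < lam0 (S J) ->
  (forall i, (S J <= i <= n)%nat -> lam0 (S J) <= lam0 i <= lam0 n) ->
  exists m, at_left T (fun t =>
    INR J * I 1%nat t + (INR n - INR J) * I n t - m
    <= sum_n_m (fun i => I i t) 1 n <= INR J * I 1%nat t + (INR n - INR J) * I n t).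
Proof.
  intros HJ Heq Hlt Hord. pose proof col_mu_pos as Hmu.
  set (s := (lam0 (S J) - lam0 1%nat) / mu).
  assert (Hs : 0 < s) by (unfold s; apply Rdiv_lt_0_compat; lra).
  exists ((INR n - INR J) * - ln s).
  assert (Hev := filter_and _ _ (at_left_lt T 0 HT) (col_gap_to_infty 0)).
  revert Hev. apply filter_imp. intros t [Ht Hgap].
  rewrite (sum_n_m_Chasles _ 1 J n) by lia.
  assert (E1 : sum_n_m (fun i => I i t) 1 J = INR J * I 1%nat t).
  { rewrite (sum_n_m_ext_loc _ (fun _ => I 1%nat t)).
    - rewrite sum_n_m_const. do 2 f_equal. lia.
    - intros i Hi. apply (flow_eq _ _ _ _ _ _ _ _ _ Hflow); [lia|lia|apply Heq, Hi|exact Ht]. }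
  assert (EnJ : INR (S n - S J) = INR n - INR J) by (rewrite <- minus_INR by lia; reflexivity).
  assert (Hlog : forall i, (S J <= i <= n)%nat -> I n t + ln s <= I i t <= I n t).
  { intros i Hi. destruct (Hord i Hi) as [Ho1 Ho2].
    pose proof (flow_combination n k cb rho0 lam0 T L I r i t ltac:(lia) Hflow ltac:(lia) Ht) as C.
    fold mu in C.
    pose proof (exp_pos (I 1%nat t)) as Hp1. pose proof (exp_pos (I n t)) as Hpn.
    assert (H1n : exp (I 1%nat t) <= exp (I n t)) by (apply exp_le_compat; lra).
    split.
    - assert (exp (I n t + ln s) <= exp (I i t)).
      { rewrite exp_plus, exp_ln by exact Hs.
        apply Rmult_le_reg_l with mu; [exact Hmu|]. rewrite C.
        replace (mu * (exp (I n t) * s)) with ((lam0 (S J) - lam0 1%nat) * exp (I n t))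
          by (unfold s; field; lra).
        assert (0 <= (lam0 n - lam0 i) * exp (I 1%nat t)) by (apply Rmult_le_pos; lra).
        assert ((lam0 (S J) - lam0 1%nat) * exp (I n t) <= (lam0 i - lam0 1%nat) * exp (I n t))
          by (apply Rmult_le_compat_r; lra).
        lra. }
      destruct (Rle_lt_dec (I n t + ln s) (I i t)) as [|Hc]; [assumption|].
      apply exp_increasing in Hc. lra.
    - assert (exp (I i t) <= exp (I n t)).
      { apply Rmult_le_reg_l with mu; [exact Hmu|]. rewrite C.
        assert ((lam0 n - lam0 i) * exp (I 1%nat t) <= (lam0 n - lam0 i) * exp (I n t))
          by (apply Rmult_le_compat_l; lra).
        unfold mu. lra. }
      destruct (Rle_lt_dec (I i t) (I n t)) as [|Hc]; [assumption|].
      apply exp_increasing in Hc. lra. }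
  assert (E2 : (INR n - INR J) * (I n t + ln s) <= sum_n_m (fun i => I i t) (S J) n).
  { rewrite <- EnJ, <- sum_n_m_const. apply sum_n_m_le_loc. intros i Hi. apply Hlog, Hi. }
  assert (E3 : sum_n_m (fun i => I i t) (S J) n <= (INR n - INR J) * I n t).
  { rewrite <- EnJ, <- sum_n_m_const. apply sum_n_m_le_loc. intros i Hi. apply Hlog, Hi. }
  rewrite E1. unfold plus; simpl. lra.
Qed.

(* Up to a bounded error [F = ln (rho P^2 / rho0)], and [rho P^2] must stay away from [0] and
   from infinity since otherwise [P'] would drift to infinity. *)
Lemma col_J_n (J : nat) :
  (1 <= J < n)%nat -> (forall i, (1 <= i <= J)%nat -> lam0 i = lam0 1%nat) ->
  lam0 1%nat < lam0 (S J) ->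
  (forall i, (S J <= i <= n)%nat -> lam0 (S J) <= lam0 i <= lam0 n) ->
  J = 2%nat /\ n = 4%nat.
Proof.
  intros HJ Heq Hlt Hord. pose proof col_mu_pos as Hmu.
  destruct (col_sum_bounds J HJ Heq Hlt Hord) as [m Hm].
  set (F := fun t => (2 - INR J) * I 1%nat t + (2 - INR n + INR J) * I n t).
  set (K := k / INR n).
  assert (HK : 0 < K).
  { apply Rdiv_lt_0_compat; [apply (col_k _ _ _ _ _ _ _ _ _ H)|apply lt_0_INR; lia]. }
  pose proof (col_rho0 _ _ _ _ _ _ _ _ _ H) as Hrho.
  pose proof (col_cb _ _ _ _ _ _ _ _ _ H) as Hcb.
  assert (Hmu2 : 0 < mu ^ 2) by (apply pow_lt, Hmu).
  assert (HKr : 0 < 2 * K * rho0) by (apply Rmult_lt_0_compat; lra).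
  assert (Hup : (forall M, at_left T (fun t => M < F t)) -> False).
  (* The threshold [3 + mu ^ 2] pays for an error of 1 in each of the two other terms of [E], for
     the limit [- mu ^ 2 / 2], and for the drift 1. *)
  { intros HF. apply (col_drift_pos 1 Rlt_0_1).
    pose proof (proj1 (filterlim_eps (at_left T) _ _ _) col_ab_lim 1 Rlt_0_1) as Hab.
    pose proof (proj1 (filterlim_eps (at_left T) _ _ _) (col_P2_lim (2 * K * cb)) 1 Rlt_0_1) as HP2.
    assert (Hev := filter_and _ _ (filter_and _ _ (at_left_lt T 0 HT) Hm)
             (filter_and _ _ (HF ((3 + mu ^ 2) / (2 * K * rho0))) (filter_and _ _ Hab HP2))).
    revert Hev. apply filter_imp. intros t [[Ht Hsum] [HFt [Habt HPt]]].
    unfold E. rewrite col_rP2 by exact Ht. fold K.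
    assert (He : 1 + F t <= exp (2 * (I 1%nat t + I n t) - sum_n_m (fun i => I i t) 1 n)).
    { apply Rle_trans with (1 := exp_ineq1_le _). apply exp_le_compat. unfold F. lra. }
    apply Rmult_lt_compat_l with (r := 2 * K * rho0) in HFt; [|exact HKr].
    replace (2 * K * rho0 * ((3 + mu ^ 2) / (2 * K * rho0))) with (3 + mu ^ 2) in HFt by (field; lra).
    apply Rmult_le_compat_l with (r := 2 * K * rho0) in He; [|lra].
    revert Habt HPt. unfold Rabs; repeat destruct Rcase_abs; lra. }
  assert (Hdown : (forall M, at_left T (fun t => M < - F t)) -> False).
  (* When [r P^2] becomes negligible, [E] is close to [- mu ^ 2 / 2] or below; two errors of
     [mu ^ 2 / 8] still leave a negative drift. *)
  { intros HF. apply (col_drift_neg (mu ^ 2 / 8)); [lra|].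
    pose proof (proj1 (filterlim_eps (at_left T) _ _ _) col_ab_lim (mu ^ 2 / 8) ltac:(lra)) as Hab.
    set (c := mu ^ 2 / 8 / (2 * K * rho0)).
    assert (Hc : 0 < c) by (unfold c; apply Rdiv_lt_0_compat; lra).
    assert (Hev := filter_and _ _ (filter_and _ _ (at_left_lt T 0 HT) Hm)
             (filter_and _ _ (HF (m - ln c)) Hab)).
    revert Hev. apply filter_imp. intros t [[Ht Hsum] [HFt Habt]].
    unfold E. rewrite col_rP2 by exact Ht. fold K.
    assert (He : exp (2 * (I 1%nat t + I n t) - sum_n_m (fun i => I i t) 1 n) <= c).
    { rewrite <- (exp_ln c) by exact Hc. apply exp_le_compat. unfold F in HFt. lra. }
    apply Rmult_le_compat_l with (r := 2 * K * rho0) in He; [|lra].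
    replace (2 * K * rho0 * c) with (mu ^ 2 / 8) in He by (unfold c; field; lra).
    assert (0 <= 2 * K * cb * P t ^ 2).
    { apply Rmult_le_pos; [apply Rmult_le_pos; lra|apply pow2_ge_0]. }
    revert Habt. unfold Rabs; destruct Rcase_abs; lra. }
  assert (HdF : forall t, 0 < t < T ->
            is_derive F t (((2 - INR J) * (L 1%nat t * P t) + (2 - INR n + INR J) * (L n t * P t)) / P t)).
  { intros t Ht. assert (D1 := col_dI1 t Ht). assert (D2 := col_dIn t Ht).
    unfold F. derivative. unfold P. field. apply Rgt_not_eq, exp_pos. }
  assert (Hlim : filterlim (fun t => (2 - INR J) * (L 1%nat t * P t) + (2 - INR n + INR J) * (L n t * P t))
            (at_left T) (locally (mu / 2 * (2 * INR J - INR n)))).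
  { replace (mu / 2 * (2 * INR J - INR n))
      with ((2 - INR J) * - (mu / 2) + (2 - INR n + INR J) * (mu / 2)) by field.
    apply filterlim_Rplus; [apply at_left_filter| |];
      (apply filterlim_Rmult; [apply at_left_filter|apply filterlim_const|]).
    - apply (col_a _ _ _ _ _ _ _ _ _ H).
    - apply (col_b _ _ _ _ _ _ _ _ _ H). }
  (* The slope of [F] against the clock thus tends to [(2 J - n) / 2]. If this is nonzero it is at
     least 1/2 in modulus by integrality, so the slope 1/4 is eventually guaranteed. *)
  pose proof (proj1 (filterlim_eps (at_left T) _ _ _) Hlim (mu / 4) ltac:(lra)) as Hnear.
  assert (Hstep : forall a b, (a < b)%nat -> INR a + 1 <= INR b).
  { intros a b Hab. rewrite <- S_INR. apply le_INR. lia. }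
  destruct (Nat.lt_trichotomy (2 * J) n) as [Hc|[Hc|Hc]].
  - exfalso. apply Hstep in Hc. rewrite mult_INR in Hc. simpl (INR 2) in Hc.
    apply Hdown.
    apply (unbounded_of_derive_ge _ _ _ _ (1 / 4) T HT ltac:(lra)
             (fun t Ht => is_derive_opp (K := R_AbsRing) (V := R_NormedModule) F t _ (HdF t Ht))
             col_dgap); [|exact col_gap_to_infty].
    revert Hnear. apply filter_imp. intros t Ht. unfold opp; simpl.
    replace (1 / 4 * (mu / P t)) with (mu / 4 * / P t) by (field; apply Rgt_not_eq, exp_pos).
    unfold Rdiv at 2. rewrite <- Ropp_mult_distr_l_reverse.
    apply Rmult_le_compat_r; [apply Rlt_le, Rinv_0_lt_compat, exp_pos|].
    assert (mu / 2 * (2 * INR J - INR n) <= - (mu / 2)) by nra.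
    revert Ht. unfold Rabs; destruct Rcase_abs; lra.
  - assert (EN : INR n = 2 * INR J) by (rewrite <- Hc, mult_INR; reflexivity).
    (* In the balanced case [F] is [(2 - J) ln P]. As ln P tends to minus infinity, [J = 1] sends
       [F] down and [J >= 3] sends it up. *)
    assert (EF : forall t, F t = (2 - INR J) * (I 1%nat t + I n t)).
    { intros t. unfold F. rewrite EN. ring. }
    destruct (Nat.lt_trichotomy J 2) as [Hj|[Hj|Hj]]; [exfalso|lia|exfalso].
    + assert (J = 1%nat) by lia. subst J. apply Hdown. intros M.
      generalize (col_lnP_to_minus_infty (- M)). apply filter_imp. intros t Ht.
      rewrite EF. simpl INR. lra.
    + apply Hup. intros M. apply Hstep in Hj. simpl (INR 2) in Hj.
      generalize (col_lnP_to_minus_infty (- Rabs M)). apply filter_imp. intros t Ht.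
      rewrite EF. pose proof (Rle_abs M). pose proof (Rabs_pos M). nra.
  - exfalso. apply Hstep in Hc. rewrite mult_INR in Hc. simpl (INR 2) in Hc.
    apply Hup.
    apply (unbounded_of_derive_ge _ _ _ _ (1 / 4) T HT ltac:(lra) HdF
             col_dgap); [|exact col_gap_to_infty].
    revert Hnear. apply filter_imp. intros t Ht.
    replace (1 / 4 * (mu / P t)) with (mu / 4 * / P t) by (field; apply Rgt_not_eq, exp_pos).
    unfold Rdiv at 2.
    apply Rmult_le_compat_r; [apply Rlt_le, Rinv_0_lt_compat, exp_pos|].
    assert (mu / 2 <= mu / 2 * (2 * INR J - INR n)) by nra.
    revert Ht. unfold Rabs; destruct Rcase_abs; lra.
Qed.

(** * Two equal lowest rates out of four: balance relation and blow-up rates *)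

Section Four.

Context (Hn4 : n = 4%nat) (Heq2 : lam0 2%nat = lam0 1%nat)
  (Hlt3 : lam0 1%nat < lam0 3%nat) (Hle3 : lam0 3%nat <= lam0 n).

(** The coefficient of u_n in u_3, hence the limit of u_3 / u_n. *)
Let s := (lam0 3%nat - lam0 1%nat) / mu.

Lemma four_s : 0 < s <= 1.
Proof.
  pose proof col_mu_pos. unfold s. split.
  - apply Rdiv_lt_0_compat; lra.
  - apply Rmult_le_reg_r with mu; [assumption|]. unfold Rdiv.
    rewrite Rmult_assoc, Rinv_l by lra. unfold mu. lra.
Qed.

Lemma four_rP2 (t : R) : 0 < t < T -> r t * P t ^ 2 = rho0 * exp (I n t - I 3%nat t).
Proof.
  intros Ht. rewrite col_rP2 by exact Ht. do 2 f_equal.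
  assert (HS : forall m, m = 4%nat ->
            sum_n_m (fun i => I i t) 1 m = I 1%nat t + I 2%nat t + I 3%nat t + I m t).
  { intros m ->. rewrite 3!sum_n_Sm, sum_n_n by lia. reflexivity. }
  rewrite (HS n Hn4).
  rewrite (flow_eq _ _ _ _ _ _ _ _ _ Hflow 2%nat 1%nat t) by (try lia; assumption).
  ring.
Qed.

Lemma four_ratio (t : R) : 0 < t < T ->
  exp (I 3%nat t - I n t) = s + (1 - s) * exp (- (I n t - I 1%nat t)).
Proof.
  intros Ht. pose proof col_mu_pos as Hmu.
  pose proof (flow_combination n k cb rho0 lam0 T L I r 3%nat t ltac:(lia) Hflow ltac:(lia) Ht) as C.
  fold mu in C.
  replace (- (I n t - I 1%nat t)) with (I 1%nat t + - I n t) by ring.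
  unfold Rminus at 1. rewrite !exp_plus, exp_Ropp.
  assert (Hp : 0 < exp (I n t)) by apply exp_pos.
  apply Rmult_eq_reg_r with (mu * exp (I n t)); [|apply Rgt_not_eq, Rmult_lt_0_compat; assumption].
  replace (exp (I 3%nat t) * / exp (I n t) * (mu * exp (I n t))) with (mu * exp (I 3%nat t))
    by (field; lra).
  rewrite C. unfold s.
  replace (lam0 n - lam0 3%nat) with (mu - (lam0 3%nat - lam0 1%nat)) by (unfold mu; ring).
  field. lra.
Qed.

Lemma four_ratio_lim : filterlim (fun t => exp (I n t - I 3%nat t)) (at_left T) (locally (/ s)).
Proof.
  pose proof four_s as Hs.
  assert (Hx : filterlim (fun t => exp (- (I n t - I 1%nat t))) (at_left T) (locally 0)).
  { apply filterlim_eps; [apply at_left_filter|]. intros e He.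
    generalize (col_gap_to_infty (- ln e)). apply filter_imp. intros t Ht.
    rewrite Rminus_0_r, Rabs_right by (apply Rle_ge, Rlt_le, exp_pos).
    rewrite <- (exp_ln e) by exact He. apply exp_increasing. lra. }
  apply (filterlim_ext_loc (fun t => / (s + (1 - s) * exp (- (I n t - I 1%nat t))))).
  - generalize (at_left_lt T 0 HT). apply filter_imp. intros t Ht.
    rewrite <- four_ratio by exact Ht. rewrite <- exp_Ropp. f_equal. ring.
  - apply filterlim_Rinv; [|lra]. replace s with (s + (1 - s) * 0) at 1 by ring.
    apply filterlim_Rplus; [apply at_left_filter|apply filterlim_const|].
    apply filterlim_Rmult; [apply at_left_filter|apply filterlim_const|exact Hx].
Qed.

Lemma four_rP2_lim : filterlim (fun t => r t * P t ^ 2) (at_left T) (locally (rho0 * / s)).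
Proof.
  apply (filterlim_ext_loc (fun t => rho0 * exp (I n t - I 3%nat t))).
  - generalize (at_left_lt T 0 HT). apply filter_imp. intros t Ht. symmetry. apply four_rP2, Ht.
  - apply filterlim_Rmult; [apply at_left_filter|apply filterlim_const|apply four_ratio_lim].
Qed.

Lemma four_K : k / INR n = k / 4.
Proof. rewrite Hn4. simpl INR. f_equal. ring. Qed.

(** Now [E] converges, to [(k / 2) rho0 / s - mu ^ 2 / 2], and the two drift lemmas leave 0 as the
    only possible limit. *)
Lemma four_balance : k * rho0 = mu ^ 2 * s.
Proof.
  pose proof four_s as Hs.
  set (c := k / 2 * (rho0 * / s) - mu ^ 2 / 2).
  assert (HE : filterlim E (at_left T) (locally c)).
  { unfold c. replace (k / 2 * (rho0 * / s) - mu ^ 2 / 2)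
      with (2 * (k / INR n) * (rho0 * / s) + -1 * 0 + - (mu ^ 2 / 2))
      by (rewrite four_K; field; lra).
    apply (filterlim_ext (fun t => 2 * (k / INR n) * (r t * P t ^ 2)
              + -1 * (2 * (k / INR n) * cb * P t ^ 2) + 2 * (L 1%nat t * P t) * (L n t * P t))).
    - intros t. unfold E. ring.
    - apply filterlim_Rplus; [apply at_left_filter| |apply col_ab_lim].
      apply filterlim_Rplus; [apply at_left_filter| |];
        (apply filterlim_Rmult; [apply at_left_filter|apply filterlim_const|]).
      + apply four_rP2_lim.
      + apply col_P2_lim. }
  assert (Hc : c = 0).
  { destruct (Rtotal_order c 0) as [Hc|[Hc|Hc]]; [exfalso|exact Hc|exfalso].
    - apply (col_drift_neg (- c / 2)); [lra|].
      generalize (proj1 (filterlim_eps (at_left T) _ _ _) HE (- c / 2) ltac:(lra)).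
      apply filter_imp. intros t. unfold Rabs; destruct Rcase_abs; lra.
    - apply (col_drift_pos (c / 2)); [lra|].
      generalize (proj1 (filterlim_eps (at_left T) _ _ _) HE (c / 2) ltac:(lra)).
      apply filter_imp. intros t. unfold Rabs; destruct Rcase_abs; lra. }
  unfold c in Hc.
  replace (k * rho0) with ((k / 2 * (rho0 * / s) - mu ^ 2 / 2) * 2 * s + mu ^ 2 * s) by (field; lra).
  rewrite Hc. ring.
Qed.

Let S t := exp ((I 1%nat t + I n t) / 2).
(** Twice the derivative of [S], the square root of u_1 u_n. *)
Let z t := S t * (L 1%nat t + L n t).

Lemma four_S2 (t : R) : S t ^ 2 = P t.
Proof. unfold S, P. simpl. rewrite Rmult_1_r, <- exp_plus. f_equal. field. Qed.

Lemma four_dS (t : R) : 0 < t < T -> is_derive S t (z t / 2).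
Proof.
  intros Ht. assert (D1 := col_dI1 t Ht). assert (D2 := col_dIn t Ht).
  unfold z, S. derivative. unfold Rdiv. ring.
Qed.

Lemma four_S_lim : filterlim S (at_left T) (locally 0).
Proof.
  apply filterlim_eps; [apply at_left_filter|]. intros e He.
  generalize (col_lnP_to_minus_infty (2 * ln e)). apply filter_imp. intros t Ht.
  rewrite Rminus_0_r, Rabs_right by (apply Rle_ge, Rlt_le, exp_pos).
  rewrite <- (exp_ln e) by exact He. apply exp_increasing. lra.
Qed.

(** By [four_balance], [k r = mu ^ 2 s exp (I n - I 3) / P ^ 2], so the density term and the squared
    Wronskian term combine into the last factor, which tends to 0. *)
Let dz t := - S t * (k / 2 * cb) - S t * mu ^ 2 / (2 * P t ^ 2) * (1 - s * exp (I n t - I 3%nat t)).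

Lemma four_dz (t : R) : 0 < t < T -> is_derive z t (dz t).
Proof.
  intros Ht.
  assert (D1 := col_dI1 t Ht). assert (D2 := col_dIn t Ht).
  assert (D3 := col_dL1 t Ht). assert (D4 := col_dLn t Ht).
  assert (HP : 0 < P t) by apply exp_pos.
  pose proof (col_wronskian t Ht) as W. pose proof (four_rP2 t Ht) as R2.
  pose proof four_balance as B. rewrite four_K in D3, D4.
  unfold z, S. derivative. change (exp ((I 1%nat t + I n t) * / 2)) with (S t).
  unfold dz.
  replace (s * exp (I n t - I 3%nat t)) with (k * (r t * P t ^ 2) / mu ^ 2).
  2: { rewrite R2. replace (k * (rho0 * exp (I n t - I 3%nat t)))
         with (k * rho0 * exp (I n t - I 3%nat t)) by ring.
       rewrite B. field. apply Rgt_not_eq, col_mu_pos. }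
  replace (S t * mu ^ 2 / (2 * P t ^ 2)) with (S t * (mu / P t) ^ 2 / 2) by (field; lra).
  replace (S t * (mu / P t) ^ 2 / 2 * (1 - k * (r t * P t ^ 2) / mu ^ 2))
    with (S t * (mu / P t) ^ 2 / 2 - S t * k * r t / 2).
  2: { field. pose proof col_mu_pos. lra. }
  rewrite <- W. field.
Qed.

(** With [e] = u_1 / u_n, [four_ratio] turns the defect into [(1 - s) e / (s + (1 - s) e)]:
    nonnegative because [s <= 1], and of order [e]. *)
Lemma four_defect (t : R) : 0 < t < T ->
  0 <= 1 - s * exp (I n t - I 3%nat t) <= / s * exp (- (I n t - I 1%nat t)).
Proof.
  intros Ht. pose proof four_s as Hs. pose proof (four_ratio t Ht) as Q.
  set (e := exp (- (I n t - I 1%nat t))) in *.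
  assert (He : 0 < e) by apply exp_pos.
  replace (I n t - I 3%nat t) with (- (I 3%nat t - I n t)) by ring.
  rewrite exp_Ropp, Q.
  assert (Hd : s <= s + (1 - s) * e).
  { assert (0 <= (1 - s) * e) by (apply Rmult_le_pos; lra). lra. }
  replace (1 - s * / (s + (1 - s) * e)) with ((1 - s) * e * / (s + (1 - s) * e)) by (field; lra).
  split.
  - apply Rmult_le_pos; [apply Rmult_le_pos; lra|apply Rlt_le, Rinv_0_lt_compat; lra].
  - rewrite (Rmult_comm (/ s)). apply Rmult_le_compat.
    + apply Rmult_le_pos; lra.
    + apply Rlt_le, Rinv_0_lt_compat; lra.
    + nra.
    + apply Rinv_le_contravar; lra.
Qed.

(** Both terms of [dz] are nonpositive, so [z] decreases; it is bounded below because the [cb] term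
    is bounded on a finite interval and the defect term is dominated by the derivative of a bounded
    function. *)
Lemma four_z_lim : exists l, l < 0 /\ filterlim z (at_left T) (locally l).
Proof.
  pose proof four_s as Hs. pose proof col_mu_pos as Hmu.
  pose proof (col_k _ _ _ _ _ _ _ _ _ H) as Hk. pose proof (col_cb _ _ _ _ _ _ _ _ _ H) as Hcb.
  assert (Hkc : 0 < k / 2 * cb) by (apply Rmult_lt_0_compat; lra).
  destruct col_In_bounded_below as [m Hm].
  assert (Hev := filter_and _ _ Hm (col_lnP_to_minus_infty 0)).
  apply at_left_iff in Hev; [|exact HT]. destruct Hev as [t0 [Ht0 Hev]].
  assert (Hfac : forall t, 0 < S t * mu ^ 2 / (2 * P t ^ 2)).
  { intros t. apply Rdiv_lt_0_compat; [apply Rmult_lt_0_compat; [apply exp_pos|apply pow_lt, Hmu]|].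
    apply Rmult_lt_0_compat; [lra|apply pow_lt, exp_pos]. }
  assert (Hdec : forall a b, t0 <= a -> a <= b -> b < T -> z b <= z a).
  { intros a b Ha Hab HbT. apply Ropp_le_cancel.
    apply (increasing_of_derive (fun t => - z t) (fun t => - dz t) t0 T); try assumption.
    - intros t Ht. apply (is_derive_opp (K := R_AbsRing) (V := R_NormedModule)).
      apply four_dz; lra.
    - intros t Ht. unfold dz. destruct (four_defect t ltac:(lra)) as [Hd _].
      specialize (Hfac t).
      assert (0 <= S t * mu ^ 2 / (2 * P t ^ 2) * (1 - s * exp (I n t - I 3%nat t)))
        by (apply Rmult_le_pos; lra).
      assert (0 <= S t * (k / 2 * cb)) by (apply Rmult_le_pos; [apply Rlt_le, exp_pos|lra]).
      lra. }
  (* The square root of u_1 / u_n decreases and stays positive, so its derivative is integrable up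
     to [T]; it dominates the defect term. *)
  set (V := fun t => exp ((I 1%nat t - I n t) / 2)).
  assert (HdV : forall t, 0 < t < T -> is_derive V t (- (V t * mu / (2 * P t)))).
  { intros t Ht. assert (D1 := col_dI1 t Ht). assert (D2 := col_dIn t Ht).
    pose proof (col_wronskian t Ht) as W. unfold V. derivative.
    assert (HP : 0 < P t) by apply exp_pos.
    replace (exp ((I 1%nat t - I n t) / 2) * mu / (2 * P t))
      with (exp ((I 1%nat t - I n t) / 2) * (mu / P t) / 2) by (field; lra).
    rewrite <- W. unfold Rdiv, Rminus. ring. }
  (* [mu / s] comes from [four_defect], and [exp (- m)] from the lower bound on [I n], which absorbs
     the surplus factor 1 / u_n. *)
  set (B := mu / s * exp (- m)).
  assert (HB : 0 < B) by (apply Rmult_lt_0_compat; [apply Rdiv_lt_0_compat; lra|apply exp_pos]).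
  assert (Hkey : forall t, t0 <= t < T ->
     S t * mu ^ 2 / (2 * P t ^ 2) * (1 - s * exp (I n t - I 3%nat t)) <= B * (V t * mu / (2 * P t))).
  { intros t Ht. destruct (Hev t Ht) as [Hmt _]. destruct (four_defect t ltac:(lra)) as [_ Hd].
    apply Rle_trans with (S t * mu ^ 2 / (2 * P t ^ 2) * (/ s * exp (- (I n t - I 1%nat t)))).
    { apply Rmult_le_compat_l; [apply Rlt_le, Hfac|exact Hd]. }
    assert (HP : 0 < P t) by apply exp_pos.
    assert (Eq : S t * exp (- (I n t - I 1%nat t)) = P t * V t * exp (- I n t)).
    { unfold S, P, V. rewrite <- !exp_plus. f_equal. field. }
    replace (S t * mu ^ 2 / (2 * P t ^ 2) * (/ s * exp (- (I n t - I 1%nat t))))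
      with (mu ^ 2 / (2 * P t ^ 2) * / s * (S t * exp (- (I n t - I 1%nat t)))) by (field; lra).
    rewrite Eq.
    replace (mu ^ 2 / (2 * P t ^ 2) * / s * (P t * V t * exp (- I n t)))
      with (mu / s * (V t * mu / (2 * P t)) * exp (- I n t)) by (field; lra).
    replace (B * (V t * mu / (2 * P t)))
      with (mu / s * (V t * mu / (2 * P t)) * exp (- m)) by (unfold B; ring).
    apply Rmult_le_compat_l.
    - apply Rmult_le_pos; [apply Rlt_le, Rdiv_lt_0_compat; lra|].
      apply Rlt_le, Rdiv_lt_0_compat; [apply Rmult_lt_0_compat; [apply exp_pos|lra]|lra].
    - apply exp_le_compat. lra. }
  assert (Hbelow : forall t, t0 <= t < T -> z t0 - B * V t0 - k / 2 * cb * T <= z t).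
  { intros t Ht.
    assert (Hmon : z t0 + k / 2 * cb * t0 - B * V t0 <= z t + k / 2 * cb * t - B * V t).
    { apply (increasing_of_derive (fun t => z t + k / 2 * cb * t - B * V t)
               (fun t => dz t + k / 2 * cb + B * (V t * mu / (2 * P t))) t0 T); try lra.
      - intros u Hu. assert (D1 := four_dz u ltac:(lra)). assert (D2 := HdV u ltac:(lra)).
        derivative. ring.
      - intros u Hu. specialize (Hkey u Hu). destruct (Hev u Hu) as [_ Hneg]. unfold dz.
        assert (S u <= 1) by (rewrite <- exp_0; apply exp_le_compat; lra).
        assert (S u * (k / 2 * cb) <= 1 * (k / 2 * cb)) by (apply Rmult_le_compat_r; lra).
        lra. }
    assert (0 < V t) by apply exp_pos.
    assert (0 < B * V t) by (apply Rmult_lt_0_compat; lra).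
    assert (k / 2 * cb * t <= k / 2 * cb * T) by (apply Rmult_le_compat_l; lra).
    assert (0 <= k / 2 * cb * t0) by (apply Rmult_le_pos; lra).
    lra. }
  destruct (decreasing_limit z t0 T _ (proj2 Ht0) Hdec Hbelow) as [l [Hl Hlz]].
  exists l. split; [|exact Hl].
  (* The limit is also a lower bound for the decreasing [z]. Were it nonnegative, [S] would be
     nondecreasing while tending to 0, yet [S] is positive. *)
  apply Rnot_le_lt. intros Hl0.
  assert (S t0 <= 0); [|pose proof (exp_pos ((I 1%nat t0 + I n t0) / 2)) as Hp; fold (S t0) in Hp; lra].
  apply (nonpos_of_increasing_to_zero S t0 T); [|apply four_S_lim|lra].
  apply (increasing_of_derive S (fun t => z t / 2)).
  - intros t Ht. apply four_dS; lra.
  - intros t Ht. specialize (Hlz t Ht). lra.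
Qed.

(** With [c = - l / 2] one has [P ~ c^2 (T - t)^2], so each rate follows from the limit of its
    product with P, and [C = mu / (2 c^2)]. The constant for [r] is [(rho0 / s) / c^4], equal to
    [(4 / k) C^2] by the balance relation. *)
Lemma four_asymptotics : exists C, 0 < C /\
  filterlim (fun t => (T - t) ^ 2 * L 1%nat t) (at_left T) (locally (- C)) /\
  filterlim (fun t => (T - t) ^ 2 * L 3%nat t) (at_left T) (locally C) /\
  filterlim (fun t => (T - t) ^ 2 * L n t) (at_left T) (locally C) /\
  filterlim (fun t => (T - t) ^ 4 * r t) (at_left T) (locally (4 / k * C ^ 2)).
Proof.
  pose proof four_s as Hs. pose proof col_mu_pos as Hmu.
  pose proof (col_k _ _ _ _ _ _ _ _ _ H) as Hk. pose proof four_balance as Hbal.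
  destruct four_z_lim as [l [Hl Hz]].
  set (c := - l / 2). assert (Hc : 0 < c) by (unfold c; lra).
  assert (HS : filterlim (fun t => S t / (T - t)) (at_left T) (locally c)).
  { apply (linear_decay S (fun t => z t / 2)); [exact HT|exact four_dS| |exact four_S_lim].
    replace (- c) with (l * / 2) by (unfold c; field).
    apply (filterlim_Rmult (at_left T) _ z (fun _ => / 2)); [exact Hz|apply filterlim_const]. }
  set (w := fun t => / (S t / (T - t))).
  assert (Hw : filterlim w (at_left T) (locally (/ c))) by (apply filterlim_Rinv; [exact HS|lra]).
  assert (Hw2 : filterlim (fun t => w t * w t) (at_left T) (locally (/ c * / c)))
    by (apply filterlim_Rmult; [apply at_left_filter| |]; exact Hw).
  assert (Ew : forall t, t < T -> w t * w t = (T - t) ^ 2 / P t).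
  { intros t Ht. assert (0 < S t) by apply exp_pos. rewrite <- four_S2. unfold w. field. lra. }
  assert (Hgen : forall f v, filterlim (fun t => f t * P t) (at_left T) (locally v) ->
     filterlim (fun t => (T - t) ^ 2 * f t) (at_left T) (locally (/ c * / c * v))).
  { intros f v Hf. apply (filterlim_ext_loc (fun t => w t * w t * (f t * P t))).
    - generalize (at_left_lt T 0 HT). apply filter_imp. intros t Ht.
      assert (0 < P t) by apply exp_pos. rewrite Ew by lra. field. lra.
    - apply filterlim_Rmult; [apply at_left_filter|exact Hw2|exact Hf]. }
  (* The Wronskian of u_3 and u_1 gives [L_3 P = L_1 P + (lam0 3 - lam0 1) u_n / u_3], whose limit
     is [- mu / 2 + mu]. *)
  assert (H3 : filterlim (fun t => L 3%nat t * P t) (at_left T) (locally (mu / 2))).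
  { apply (filterlim_ext_loc (fun t => L 1%nat t * P t
             + (lam0 3%nat - lam0 1%nat) * exp (I n t - I 3%nat t))).
    - generalize (at_left_lt T 0 HT). apply filter_imp. intros t Ht.
      rewrite <- (flow_wronskian _ _ _ _ _ _ _ _ _ Hflow 3%nat 1%nat t) by (try lia; exact Ht).
      unfold P, Rminus. rewrite !exp_plus, exp_Ropp. field. apply Rgt_not_eq, exp_pos.
    - replace (mu / 2) with (- (mu / 2) + (lam0 3%nat - lam0 1%nat) * / s)
        by (unfold s; field; lra).
      apply filterlim_Rplus; [apply at_left_filter|apply (col_a _ _ _ _ _ _ _ _ _ H)|].
      apply filterlim_Rmult; [apply at_left_filter|apply filterlim_const|apply four_ratio_lim]. }
  exists (/ c * / c * (mu / 2)). split.
  { repeat apply Rmult_lt_0_compat; try lra; apply Rinv_0_lt_compat, Hc. }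
  split.
  { rewrite Ropp_mult_distr_r. apply Hgen, (col_a _ _ _ _ _ _ _ _ _ H). }
  split; [apply Hgen, H3|].
  split; [apply Hgen, (col_b _ _ _ _ _ _ _ _ _ H)|].
  apply (filterlim_ext_loc (fun t => (w t * w t) * (w t * w t) * (r t * P t ^ 2))).
  - generalize (at_left_lt T 0 HT). apply filter_imp. intros t Ht.
    assert (0 < P t) by apply exp_pos. rewrite Ew by lra. field. lra.
  - replace (4 / k * (/ c * / c * (mu / 2)) ^ 2)
      with ((/ c * / c) * (/ c * / c) * (rho0 * / s)).
    + apply filterlim_Rmult; [apply at_left_filter| |apply four_rP2_lim].
      apply filterlim_Rmult; [apply at_left_filter| |]; exact Hw2.
    + replace rho0 with (mu ^ 2 * s / k) by (rewrite <- Hbal; field; lra). field. lra.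
Qed.

End Four.

End Collapse.

Theorem theorem5p2 (n J : nat) (k cb rho0 : R) (lam0 : nat -> R) (tB : R)
    (lam : nat -> R -> R) (rho : R -> R) (p q : R) :
  (2 <= n)%nat ->
  0 < k -> 0 < cb -> 0 < rho0 ->
  (1 <= J <= n)%nat ->
  (forall i, (1 <= i <= J)%nat -> lam0 i = lam0 1%nat) ->
  ((J < n)%nat -> lam0 J < lam0 (S J)) ->
  (forall i, (J + 1 <= i)%nat -> (i < n)%nat -> lam0 i <= lam0 (S i)) ->
  0 < tB ->
  is_maximal_sol n k cb rho0 lam0 tB lam rho ->
  filterlim (fun t => Derive (u_fun lam 1%nat) t * u_fun lam n t)
    (at_left tB) (locally (- p)) ->
  filterlim (fun t => u_fun lam 1%nat t * Derive (u_fun lam n) t)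
    (at_left tB) (locally q) ->
  p = q ->
  J = 2%nat /\ n = 4%nat /\
  (lam0 1%nat - lam0 3%nat) * (lam0 1%nat - lam0 4%nat) = k * rho0 /\
  exists C : R, 0 < C /\
    filterlim (fun t => (tB - t)^2 * lam 1%nat t) (at_left tB) (locally (- C)) /\
    filterlim (fun t => (tB - t)^2 * lam 3%nat t) (at_left tB) (locally C) /\
    filterlim (fun t => (tB - t)^2 * lam 4%nat t) (at_left tB) (locally C) /\
    filterlim (fun t => (tB - t)^4 * rho t) (at_left tB) (locally (4 / k * C^2)).
Proof.
  intros Hn Hk Hcb Hrho HJ Heq Hlt Hle HT Hmax Hp Hq Epq.
  pose proof (flow_of_sol n k cb rho0 lam0 tB lam rho HT (proj1 Hmax)) as Hflow.
  set (I := fun i t => RInt (lam i) 0 t) in Hflow.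
  assert (Hder : forall i t, (1 <= i <= n)%nat -> 0 < t < tB ->
            Derive (u_fun lam i) t = lam i t * exp (I i t)).
  { intros i t Hi Ht. apply is_derive_unique.
    assert (D := flow_dI _ _ _ _ _ _ _ _ _ Hflow i t Hi Ht).
    apply (is_derive_ext (fun t => exp (I i t))); [reflexivity|]. derivative. ring. }
  assert (Ha : filterlim (fun t => lam 1%nat t * exp (I 1%nat t + I n t)) (at_left tB) (locally (- p))).
  { revert Hp. apply filterlim_ext_loc. generalize (at_left_lt tB 0 HT). apply filter_imp.
    intros t Ht. rewrite Hder by (try lia; exact Ht). rewrite exp_plus.
    change (u_fun lam n t) with (exp (I n t)). ring. }
  assert (Hb : filterlim (fun t => lam n t * exp (I 1%nat t + I n t)) (at_left tB) (locally q)).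
  { revert Hq. apply filterlim_ext_loc. generalize (at_left_lt tB 0 HT). apply filter_imp.
    intros t Ht. rewrite Hder by (try lia; exact Ht). rewrite exp_plus.
    change (u_fun lam 1%nat t) with (exp (I 1%nat t)). ring. }
  assert (Epq2 : - p - q = lam0 1%nat - lam0 n).
  { apply (filterlim_locally_unique (F := at_left tB)
             (fun t => lam 1%nat t * exp (I 1%nat t + I n t) - lam n t * exp (I 1%nat t + I n t))).
    - replace (- p - q) with (- p + -1 * q) by ring.
      apply (filterlim_ext (fun t => lam 1%nat t * exp (I 1%nat t + I n t)
                                     + -1 * (lam n t * exp (I 1%nat t + I n t)))); [intros; ring|].
      apply filterlim_Rplus; [apply at_left_filter|exact Ha|].
      apply filterlim_Rmult; [apply at_left_filter|apply filterlim_const|exact Hb].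
    - apply (filterlim_ext_loc (fun _ => lam0 1%nat - lam0 n)); [|apply filterlim_const].
      generalize (at_left_lt tB 0 HT). apply filter_imp. intros t Ht.
      rewrite <- (flow_wronskian _ _ _ _ _ _ _ _ _ Hflow 1%nat n t) by (try lia; exact Ht).
      rewrite exp_plus. ring. }
  assert (Hchain : forall i j, (J < i)%nat -> (i <= j <= n)%nat -> lam0 i <= lam0 j).
  { intros i j Hi [Hij Hj]. induction Hij as [|j Hij IH]; [apply Rle_refl|].
    apply Rle_trans with (lam0 j); [apply IH; lia|apply Hle; lia]. }
  assert (HJ1 : lam0 J = lam0 1%nat) by (apply Heq; lia).
  assert (Hord : forall i, (1 <= i <= n)%nat -> lam0 1%nat <= lam0 i <= lam0 n).
  { intros i Hi. destruct (le_lt_dec i J) as [HiJ|HiJ].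
    - rewrite (Heq i) by lia. split; [apply Rle_refl|].
      destruct (Nat.eq_dec J n) as [<-|HJn]; [lra|].
      apply Rle_trans with (lam0 (S J)); [rewrite <- HJ1; apply Rlt_le, Hlt; lia|apply Hchain; lia].
    - split; [|apply Hchain; lia].
      apply Rle_trans with (lam0 (S J)); [rewrite <- HJ1; apply Rlt_le, Hlt; lia|apply Hchain; lia]. }
  assert (HP0 : filterlim (fun t => exp (I 1%nat t + I n t)) (at_left tB) (locally 0)).
  { destruct (vanish_or_bounded_below (fun t => exp (I 1%nat t + I n t))
                (fun t => lam 1%nat t * exp (I 1%nat t + I n t) + lam n t * exp (I 1%nat t + I n t)) tB HT)
      as [H0|[d [Hd Hbd]]].
    - intros t _. apply exp_pos.
    - intros t Ht. assert (D1 := flow_dI _ _ _ _ _ _ _ _ _ Hflow 1%nat t ltac:(lia) Ht).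
      assert (D2 := flow_dI _ _ _ _ _ _ _ _ _ Hflow n t ltac:(lia) Ht). derivative. ring.
    - replace 0 with (- p + q) by lra. apply filterlim_Rplus; [apply at_left_filter|exact Ha|exact Hb].
    - exact H0.
    - exfalso. apply (not_maximal_of_lower_bound n k cb rho0 lam0 tB lam I rho d (- p) q);
        try assumption. lia. }
  (* If [J = n], all initial rates coincide, P is the square of u_1, and its vanishing is a radial
     collapse. *)
  destruct (Nat.eq_dec J n) as [HJn|HJn].
  { exfalso.
    apply (no_radial_collapse n k cb rho0 lam0 tB lam I rho); try assumption.
    - intros i Hi. apply Heq. lia.
    - intros m. pose proof (proj1 (filterlim_eps (at_left tB) _ _ _) HP0 (exp (2 * m)) (exp_pos _)) as Hev.
      generalize (filter_and _ _ (at_left_lt tB 0 HT) Hev). apply filter_imp. intros t [Ht Hlt'].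
      rewrite (flow_eq _ _ _ _ _ _ _ _ _ Hflow n 1%nat t) in Hlt' by (try lia; try exact Ht; apply Heq; lia).
      rewrite Rminus_0_r, Rabs_right in Hlt' by (apply Rle_ge, Rlt_le, exp_pos).
      apply exp_lt_inv in Hlt'. lra. }
  assert (HltJ : lam0 1%nat < lam0 (S J)) by (rewrite <- HJ1; apply Hlt; lia).
  assert (Hmu : lam0 1%nat < lam0 n).
  { apply Rlt_le_trans with (1 := HltJ). apply Hchain; lia. }
  assert (Hcol : collapsing n k cb rho0 lam0 tB lam I rho).
  { split; try assumption.
    - replace (- ((lam0 n - lam0 1%nat) / 2)) with (- p) by lra. exact Ha.
    - replace ((lam0 n - lam0 1%nat) / 2) with q by lra. exact Hb. }
  destruct (col_J_n n k cb rho0 lam0 tB lam I rho Hcol J) as [EJ En]; try assumption; try lia.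
  { intros i Hi. split; apply Hchain; lia. }
  subst J.
  assert (E2 : lam0 2%nat = lam0 1%nat) by exact HJ1.
  assert (H34 : lam0 3%nat <= lam0 n) by (apply Hchain; lia).
  split; [reflexivity|]. split; [exact En|]. split.
  - rewrite (four_balance n k cb rho0 lam0 tB lam I rho Hcol En E2 HltJ H34).
    replace (lam0 4%nat) with (lam0 n) by (rewrite En; reflexivity). field. lra.
  - destruct (four_asymptotics n k cb rho0 lam0 tB lam I rho Hcol En E2 HltJ H34)
      as [C [HC [A1 [A3 [A4 Ar]]]]].
    exists C. rewrite En in A4. auto.
Qed.
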